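(* Let $A$ be a complex unital Banach algebra and $a,b\in A$ with $d_\rho(a,b)=0$. Suppose $h$ is an entire complex function, not identically zero, all of whose zeros are simple, and that the holomorphic functional calculus elements satisfy $h(a)=h(b)=0$. Then $a=b$.
   Context: For $a,b\in A$ and $n\geq 0$ put $C_{a,b}^n\mathbf 1=\sum_{k=0}^n(-1)^k\binom{n}{k}a^{n-k}b^k$ (with $a^0=b^0=\mathbf 1$). Define $\rho(a,b)=\limsup_{n\to\infty}\|C_{a,b}^n\mathbf 1\|^{1/n}$ and $d_\rho(a,b)=\max\{\rho(a,b),\rho(b,a)\}$. *)

(* Defs.v *)
From Stdlib Require Import Reals List.
Open Scope R_scope.

Record Cplx := mkC { Re : R ; Im : R }.
Definition RtoC (r : R) : Cplx := mkC r 0.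
Definition C0 : Cplx := RtoC 0.
Definition C1 : Cplx := RtoC 1.
Definition Cadd (z w : Cplx) : Cplx := mkC (Re z + Re w) (Im z + Im w).
Definition Copp (z : Cplx) : Cplx := mkC (- Re z) (- Im z).
Definition Csub (z w : Cplx) : Cplx := Cadd z (Copp w).
Definition Cmul (z w : Cplx) : Cplx :=
  mkC (Re z * Re w - Im z * Im w) (Re z * Im w + Im z * Re w).
Definition Cmod (z : Cplx) : R := sqrt (Re z * Re z + Im z * Im z).
Fixpoint Cpow (z : Cplx) (n : nat) : Cplx :=
  match n with O => C1 | S m => Cmul z (Cpow z m) end.

Record BanachAlgebra := {
  car :> Type;
  bzero : car; bone : car;
  badd : car -> car -> car; bopp : car -> car; bmul : car -> car -> car;
  bscal : Cplx -> car -> car;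
  bnorm : car -> R;
  badd_assoc : forall x y z, badd x (badd y z) = badd (badd x y) z;
  badd_comm : forall x y, badd x y = badd y x;
  badd_0 : forall x, badd bzero x = x;
  badd_opp : forall x, badd x (bopp x) = bzero;
  bmul_assoc : forall x y z, bmul x (bmul y z) = bmul (bmul x y) z;
  bmul_1l : forall x, bmul bone x = x;
  bmul_1r : forall x, bmul x bone = x;
  bmul_addl : forall x y z, bmul (badd x y) z = badd (bmul x z) (bmul y z);
  bmul_addr : forall x y z, bmul x (badd y z) = badd (bmul x y) (bmul x z);
  bscal_assoc : forall c d x, bscal c (bscal d x) = bscal (Cmul c d) x;
  bscal_1 : forall x, bscal C1 x = x;
  bscal_addr : forall c x y, bscal c (badd x y) = badd (bscal c x) (bscal c y);
  bscal_addl : forall c d x, bscal (Cadd c d) x = badd (bscal c x) (bscal d x);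
  bscal_mull : forall c x y, bscal c (bmul x y) = bmul (bscal c x) y;
  bscal_mulr : forall c x y, bscal c (bmul x y) = bmul x (bscal c y);
  bnorm_eq0 : forall x, bnorm x = 0 -> x = bzero;
  bnorm_triangle : forall x y, bnorm (badd x y) <= bnorm x + bnorm y;
  bnorm_scal : forall c x, bnorm (bscal c x) = Cmod c * bnorm x;
  bnorm_submult : forall x y, bnorm (bmul x y) <= bnorm x * bnorm y;
  bcomplete : forall u : nat -> car,
    (forall eps, eps > 0 -> exists N, forall m n, (m >= N)%nat -> (n >= N)%nat ->
        bnorm (badd (u m) (bopp (u n))) < eps) ->
    exists l, forall eps, eps > 0 -> exists N, forall n, (n >= N)%nat ->
        bnorm (badd (u n) (bopp l)) < eps
}.

Section BA.
Variable A : BanachAlgebra.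

Fixpoint bpow (a : A) (n : nat) : A :=
  match n with O => bone A | S m => bmul A a (bpow a m) end.

Definition bsum (f : nat -> A) (n : nat) : A :=
  fold_right (fun k acc => badd A (f k) acc) (bzero A) (seq 0 (S n)).

(* C_{a,b}^n 1 = \sum_{k=0}^n (-1)^k binom(n,k) a^{n-k} b^k *)
Definition Cab (a b : A) (n : nat) : A :=
  bsum (fun k => bscal A (RtoC ((-1) ^ k * Binomial.C n k))
                   (bmul A (bpow a (n - k)) (bpow b k))) n.

End BA.

(* nonnegative n-th root of x >= 0 (with the convention 0^{1/n} = 0) *)
Definition nroot (n : nat) (x : R) : R :=
  if Rle_dec x 0 then 0 else Rpower x (/ INR n).

(* limsup_{n->oo} u n <= 0; for a nonnegative sequence this says limsup u = 0 *)
Definition limsup_le0 (u : nat -> R) : Prop :=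
  forall eps, eps > 0 -> exists N, forall n, (n >= N)%nat -> u n <= eps.

Definition rho_zero (A : BanachAlgebra) (a b : A) : Prop :=
  limsup_le0 (fun n => nroot n (bnorm A (Cab A a b n))).

(* d_rho(a,b) = max(rho(a,b), rho(b,a)) = 0 *)
Definition d_rho_zero (A : BanachAlgebra) (a b : A) : Prop :=
  rho_zero A a b /\ rho_zero A b a.

Fixpoint Csum (f : nat -> Cplx) (n : nat) : Cplx :=
  match n with O => f O | S m => Cadd (Csum f m) (f n) end.

Definition ps_conv (c : nat -> Cplx) (z w : Cplx) : Prop :=
  forall eps, eps > 0 -> exists N, forall n, (n >= N)%nat ->
    Cmod (Csub (Csum (fun k => Cmul (c k) (Cpow z k)) n) w) < eps.

Definition entire_with_coeffs (h : Cplx -> Cplx) (c : nat -> Cplx) : Prop :=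
  forall z, ps_conv c z (h z).

Definition Cderiv (h : Cplx -> Cplx) (z w : Cplx) : Prop :=
  forall eps, eps > 0 -> exists delta, delta > 0 /\ forall u, Cmod u < delta ->
    Cmod (Csub (Csub (h (Cadd z u)) (h z)) (Cmul w u)) <= eps * Cmod u.

Definition fcalc (A : BanachAlgebra) (c : nat -> Cplx) (a x : A) : Prop :=
  forall eps, eps > 0 -> exists N, forall n, (n >= N)%nat ->
    bnorm A (badd A (bsum A (fun k => bscal A (c k) (bpow A a k)) n) (bopp A x)) < eps.

(* Main.v *)
(* Only finitely many zeros of [h] lie in a large disc, and dividing them out
   gives [h(a) = p(a) g(a)] with [p] a product of distinct linear factors and
   [g] entire, bounded below on the disc.  The Taylor polynomials of [g] split,
   their zeros lie outside the disc, so their inverses are power series; Cauchy's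
   estimate bounds these inverses at [a] uniformly, whence [p(a) = 0].  Likewise
   [p(b) = 0].  Thus [1] is a sum of vectors [v] with [v a = lam v] and a sum of
   vectors [w] with [b w = mu w].  Since [v C^n w = (lam - mu)^n v w], where [C^n]
   is [Cab a b n], has vanishing n-th root asymptotics, [v w = 0] unless
   [lam = mu], so that [v (a - b) w = (lam - mu) v w = 0] always. *)

From mathcomp Require all_boot all_algebra complex Rstruct.
From Stdlib Require Import Reals Lra Lia List Classical ClassicalEpsilon.
From Coquelicot Require Import Compactness.
Require Import Defs.
Open Scope R_scope.

(* The obstacle is the inverse of [g] at [a]. Everything is done with bounds on coefficients instead
   of contour integrals or spectra, and for polynomials an inverse series can be written down root
   by root. The bound obtained in this way depends on the roots, hence on the degree, and is useless
   in the limit. Cauchy's estimate trades it, at the price of halving the radius, for one that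
   depends only on the lower bound of [g] on the disc. Simplicity of the zeros enters three times:
   it isolates them, it keeps [g] from vanishing at a zero already divided out, and it makes the
   linear factors distinct, so that multiplication by [a] or [b] is diagonalizable. Identities
   between series are proved in all Banach algebras at once; the complex numbers are one of them, so
   the same identity gives values of functions and elements of [A]. *)
Declare Scope cplx_scope.
Delimit Scope cplx_scope with C.
Bind Scope cplx_scope with Cplx.
Notation "z + w" := (Cadd z w) : cplx_scope.
Notation "z * w" := (Cmul z w) : cplx_scope.
Notation "- z" := (Copp z) : cplx_scope.
Notation "z - w" := (Csub z w) : cplx_scope.

Declare Scope alg_scope.
Delimit Scope alg_scope with A.
Notation "x + y" := (badd _ x y) : alg_scope.
Notation "x * y" := (bmul _ x y) : alg_scope.
Notation "- x" := (bopp _ x) : alg_scope.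
Notation "x - y" := (badd _ x (bopp _ y)) : alg_scope.
Notation "c *: x" := (bscal _ c x) (at level 40) : alg_scope.
Notation "0" := (bzero _) : alg_scope.
Notation "1" := (bone _) : alg_scope.

(** * Complex numbers *)

Lemma Cplx_ext (z w : Cplx) : Re z = Re w -> Im z = Im w -> z = w.
Proof. destruct z, w; simpl; intros -> ->; reflexivity. Qed.

Definition Cinv (z : Cplx) : Cplx :=
  let m := Re z * Re z + Im z * Im z in mkC (Re z / m) (- Im z / m).

Lemma sqr_sum_neq0 (z : Cplx) : z <> C0 -> Re z * Re z + Im z * Im z <> 0.
Proof.
  intros Hz H; apply Hz; apply Cplx_ext; simpl; nra.
Qed.

Lemma Cplx_field : field_theory C0 C1 Cadd Cmul Csub Copp
  (fun z w => (z * Cinv w)%C) Cinv (@eq Cplx).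
Proof.
  split.
  - split; intros; apply Cplx_ext; simpl; ring.
  - intros H; injection H; lra.
  - reflexivity.
  - intros z Hz; apply sqr_sum_neq0 in Hz.
    apply Cplx_ext; simpl; field; assumption.
Qed.

Add Field Cplx_field_inst : Cplx_field.

Lemma Cmod_ge0 (z : Cplx) : 0 <= Cmod z.
Proof. apply sqrt_pos. Qed.

Lemma Cmod_sqr (z : Cplx) : Cmod z * Cmod z = Re z * Re z + Im z * Im z.
Proof. apply sqrt_sqrt; nra. Qed.

Lemma Cmod_mul (z w : Cplx) : Cmod (z * w)%C = Cmod z * Cmod w.
Proof.
  unfold Cmod; rewrite <- sqrt_mult by nra.
  f_equal; simpl; ring.
Qed.

Lemma Cmod_RtoC (r : R) : Cmod (RtoC r) = Rabs r.
Proof.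
  unfold Cmod; simpl; rewrite Rmult_0_l, Rplus_0_r; apply sqrt_Rsqr_abs.
Qed.

Lemma Cmod_0 : Cmod C0 = 0.
Proof. unfold C0; rewrite Cmod_RtoC; apply Rabs_R0. Qed.

Lemma Cmod_1 : Cmod C1 = 1.
Proof. unfold C1; rewrite Cmod_RtoC; apply Rabs_R1. Qed.

Lemma Cmod_eq0 (z : Cplx) : Cmod z = 0 -> z = C0.
Proof.
  intros H; pose proof (Cmod_sqr z) as E; rewrite H in E.
  apply Cplx_ext; simpl; nra.
Qed.

Lemma Cmod_gt0 (z : Cplx) : z <> C0 -> 0 < Cmod z.
Proof.
  intros Hz; destruct (Cmod_ge0 z) as [H|H]; [exact H|].
  exfalso; apply Hz, Cmod_eq0; auto.
Qed.

Lemma Cmod_opp (z : Cplx) : Cmod (- z)%C = Cmod z.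
Proof. unfold Cmod; f_equal; simpl; ring. Qed.

Lemma Cmod_triangle (z w : Cplx) : Cmod (z + w)%C <= Cmod z + Cmod w.
Proof.
  apply Rsqr_incr_0_var; [|pose proof (Cmod_ge0 z); pose proof (Cmod_ge0 w); lra].
  pose proof (Cmod_ge0 z); pose proof (Cmod_ge0 w).
  (* Cauchy-Schwarz by Lagrange's identity: the squares of the two sides differ by the square of
     [Re z * Im w - Im z * Re w]. *)
  assert (H1 : Re z * Re w + Im z * Im w <= Cmod z * Cmod w).
  { apply Rsqr_incr_0_var; [unfold Rsqr|nra].
    replace (Cmod z * Cmod w * (Cmod z * Cmod w))
      with ((Cmod z * Cmod z) * (Cmod w * Cmod w)) by ring.
    rewrite !Cmod_sqr.
    pose proof (Rle_0_sqr (Re z * Im w - Im z * Re w)); unfold Rsqr in *; nra. }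
  pose proof (Cmod_sqr z); pose proof (Cmod_sqr w); pose proof (Cmod_sqr (z + w)%C).
  unfold Rsqr; simpl in *; nra.
Qed.

Lemma Cmod_sub_sym (z w : Cplx) : Cmod (z - w)%C = Cmod (w - z)%C.
Proof. rewrite <- Cmod_opp; f_equal; ring. Qed.

Lemma Cmod_triangle_inv (z w : Cplx) : Cmod z - Cmod w <= Cmod (z - w)%C.
Proof.
  pose proof (Cmod_triangle (z - w) w)%C as H.
  replace (z - w + w)%C with z in H by ring; lra.
Qed.

Lemma Cmod_pow (z : Cplx) (n : nat) : Cmod (Cpow z n) = Cmod z ^ n.
Proof.
  induction n as [|n IH]; simpl; [apply Cmod_1|].
  rewrite Cmod_mul, IH; reflexivity.
Qed.

Lemma Cmul_eq0 (z w : Cplx) : (z * w)%C = C0 -> z = C0 \/ w = C0.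
Proof.
  intros H; destruct (classic (z = C0)) as [|Hz]; [now left|right].
  replace w with (Cinv z * (z * w))%C by (field; assumption).
  rewrite H; ring.
Qed.

Lemma Csub_eq0 (z w : Cplx) : (z - w)%C = C0 -> z = w.
Proof. intros H; replace z with (z - w + w)%C by ring; rewrite H; ring. Qed.

Lemma Re_le_Cmod (z : Cplx) : Rabs (Re z) <= Cmod z.
Proof.
  rewrite <- sqrt_Rsqr_abs; apply sqrt_le_1_alt; unfold Rsqr; nra.
Qed.

Lemma Im_le_Cmod (z : Cplx) : Rabs (Im z) <= Cmod z.
Proof.
  rewrite <- sqrt_Rsqr_abs; apply sqrt_le_1_alt; unfold Rsqr; nra.
Qed.

Lemma Cmod_le_Re_Im (z : Cplx) : Cmod z <= Rabs (Re z) + Rabs (Im z).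
Proof.
  replace z with (RtoC (Re z) + mkC 0 1 * RtoC (Im z))%C
    by (apply Cplx_ext; simpl; ring).
  eapply Rle_trans; [apply Cmod_triangle|].
  rewrite Cmod_mul, !Cmod_RtoC; simpl.
  replace (Cmod (mkC 0 1)) with 1.
  - apply Req_le; f_equal; [|rewrite Rmult_1_l]; f_equal; ring.
  - unfold Cmod; simpl; replace (0 * 0 + 1 * 1) with 1 by ring; now rewrite sqrt_1.
Qed.

(** * Normed algebra *)

Section AlgebraIdentities.
Variable A : BanachAlgebra.

Lemma badd_0r (x : A) : (x + 0)%A = x.
Proof. rewrite badd_comm; apply badd_0. Qed.

Lemma badd_cancel_l (x y z : A) : (x + y = x + z)%A -> y = z.
Proof.
  intros H.
  rewrite <- (badd_0 A y), <- (badd_0 A z), <- (badd_opp A x).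
  rewrite (badd_comm A x), <- !badd_assoc, H; reflexivity.
Qed.

Lemma bscal_C0 (x : A) : (C0 *: x)%A = bzero A.
Proof.
  apply (badd_cancel_l (C0 *: x)%A).
  rewrite <- bscal_addl, badd_0r; f_equal; ring.
Qed.

Lemma bscal_0 (c : Cplx) : (c *: 0)%A = bzero A.
Proof.
  apply (badd_cancel_l (c *: 0)%A).
  now rewrite <- bscal_addr, !badd_0r.
Qed.

Lemma bopp_scal (x : A) : (- x)%A = ((- C1)%C *: x)%A.
Proof.
  apply (badd_cancel_l x); rewrite badd_opp.
  rewrite <- (bscal_1 A x) at 1; rewrite <- bscal_addl.
  symmetry; rewrite <- (bscal_C0 x); f_equal; ring.
Qed.

Lemma bmul_0l (x : A) : (0 * x)%A = bzero A.
Proof. rewrite <- (bscal_C0 0)%A at 1; rewrite <- bscal_mull; apply bscal_C0. Qed.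

Lemma bmul_0r (x : A) : (x * 0)%A = bzero A.
Proof. rewrite <- (bscal_C0 0)%A at 1; rewrite <- bscal_mulr; apply bscal_C0. Qed.

Lemma bmul_oppl (x y : A) : (- x * y)%A = (- (x * y))%A.
Proof. rewrite !bopp_scal; symmetry; apply bscal_mull. Qed.

Lemma bmul_oppr (x y : A) : (x * - y)%A = (- (x * y))%A.
Proof. rewrite !bopp_scal; symmetry; apply bscal_mulr. Qed.

Lemma bmul_scall (c : Cplx) (x y : A) : ((c *: x) * y)%A = (c *: (x * y))%A.
Proof. symmetry; apply bscal_mull. Qed.

Lemma bmul_scalr (c : Cplx) (x y : A) : (x * (c *: y))%A = (c *: (x * y))%A.
Proof. symmetry; apply bscal_mulr. Qed.

Lemma bmul_assoc_r (x y z : A) : ((x * y) * z)%A = (x * (y * z))%A.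
Proof. symmetry; apply bmul_assoc. Qed.

(* The square-zero extension of the scalars by the module [A] is a
   commutative ring, so that [ring] on it decides module identities in [A]. *)
Record sqz := Sqz { sqz_scal : Cplx; sqz_vec : A }.
Definition sqz_add (p q : sqz) :=
  Sqz (sqz_scal p + sqz_scal q) (sqz_vec p + sqz_vec q)%A.
Definition sqz_mul (p q : sqz) :=
  Sqz (sqz_scal p * sqz_scal q)
      (sqz_scal p *: sqz_vec q + sqz_scal q *: sqz_vec p)%A.
Definition sqz_opp (p : sqz) := Sqz (- sqz_scal p) (- sqz_vec p)%A.
Definition inj_scal (c : Cplx) := Sqz c (bzero A).
Definition inj_vec (x : A) := Sqz C0 x.

Lemma badd_swap (x y z t : A) : ((x + y) + (z + t) = (x + z) + (y + t))%A.
Proof.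
  rewrite <- !badd_assoc; f_equal; rewrite !badd_assoc; f_equal; apply badd_comm.
Qed.

Lemma sqz_ring : ring_theory (inj_scal C0) (inj_scal C1) sqz_add sqz_mul
  (fun p q => sqz_add p (sqz_opp q)) sqz_opp (@eq sqz).
Proof.
  split; intros; repeat match goal with p : sqz |- _ => destruct p end;
    unfold sqz_add, sqz_mul, sqz_opp, inj_scal; cbn [sqz_scal sqz_vec];
    try reflexivity; (f_equal; [ring|]).
  - apply badd_0.
  - apply badd_comm.
  - apply badd_assoc.
  - now rewrite bscal_1, bscal_0, badd_0r.
  - apply badd_comm.
  - rewrite !bscal_addr, !bscal_assoc, <- badd_assoc; f_equal; f_equal;
      f_equal; ring.
  - rewrite bscal_addl, bscal_addr; apply badd_swap.
  - apply badd_opp.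
Qed.

Lemma inj_vec_inj (x y : A) : inj_vec x = inj_vec y -> x = y.
Proof. now intros [=]. Qed.

Lemma inj_vec_add (x y : A) : inj_vec (x + y)%A = sqz_add (inj_vec x) (inj_vec y).
Proof. unfold inj_vec, sqz_add; simpl; f_equal; ring. Qed.

Lemma inj_vec_opp (x : A) : inj_vec (- x)%A = sqz_opp (inj_vec x).
Proof. unfold inj_vec, sqz_opp; simpl; f_equal; ring. Qed.

Lemma inj_vec_0 : inj_vec (bzero A) = inj_scal C0.
Proof. reflexivity. Qed.

Lemma inj_vec_scal (c : Cplx) (x : A) :
  inj_vec (c *: x)%A = sqz_mul (inj_scal c) (inj_vec x).
Proof.
  unfold inj_vec, sqz_mul; simpl; f_equal; [ring|].
  now rewrite bscal_0, badd_0r.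
Qed.

Lemma inj_scal_add (c d : Cplx) : inj_scal (c + d) = sqz_add (inj_scal c) (inj_scal d).
Proof. unfold inj_scal, sqz_add; simpl; f_equal; now rewrite badd_0r. Qed.

Lemma inj_scal_mul (c d : Cplx) : inj_scal (c * d) = sqz_mul (inj_scal c) (inj_scal d).
Proof.
  unfold inj_scal, sqz_mul; simpl; f_equal; now rewrite !bscal_0, badd_0r.
Qed.

Lemma inj_scal_opp (c : Cplx) : inj_scal (- c) = sqz_opp (inj_scal c).
Proof.
  unfold inj_scal, sqz_opp; simpl; f_equal; now rewrite bopp_scal, bscal_0.
Qed.

Lemma inj_scal_sub (c d : Cplx) :
  inj_scal (c - d) = sqz_add (inj_scal c) (sqz_opp (inj_scal d)).
Proof. unfold Csub; now rewrite inj_scal_add, inj_scal_opp. Qed.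

End AlgebraIdentities.

(** Products are expanded into right-nested words with scalars pulled out; the words are then atoms
    of a complex module. Only these atoms and scalars reach [ring], so the noncommutative product is
    never subjected to commutativity. *)
Ltac algebra :=
  repeat progress rewrite ?bmul_addl, ?bmul_addr, ?bmul_oppl, ?bmul_oppr,
    ?bmul_scall, ?bmul_scalr, ?bmul_assoc_r, ?bmul_0l, ?bmul_0r,
    ?bmul_1l, ?bmul_1r;
  apply inj_vec_inj;
  repeat progress rewrite ?inj_vec_add, ?inj_vec_opp, ?inj_vec_0, ?inj_vec_scal,
    ?inj_scal_sub, ?inj_scal_add, ?inj_scal_mul, ?inj_scal_opp;
  ring.

(** * Fundamental theorem of algebra *)

Section ClosedField.
Import all_boot all_algebra complex Rstruct.

Let toC (z : Cplx) : complex R := let: mkC u v := z in complex.Complex u v.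
Let ofC (x : complex R) : Cplx := let: complex.Complex u v := x in mkC u v.

(** Transport along the bijection [toC] to [complex R], which is algebraically closed because [R] is
    real closed. The monic shape is that of the closed field axiom. *)
Lemma monic_root (n : nat) (c : nat -> Cplx) :
  exists z, Cpow z (S n) = Csum (fun k => Cmul (c k) (Cpow z k)) n.
Proof.
have toC_mul z w : toC (Cmul z w) = (toC z * toC w)%R.
  by case: z w => [? ?] [? ?].
have toC_add z w : toC (Cadd z w) = (toC z + toC w)%R.
  by case: z w => [? ?] [? ?].
have toC_pow z k : toC (Cpow z k) = (toC z ^+ k)%R.
  elim: k => [|k IH]; first by [].
  by rewrite GRing.exprS -IH -toC_mul.
have toC_inj z w : toC z = toC w -> z = w.
  by case: z w => [? ?] [? ?] [-> ->].
have [x] := @GRing.solve_monicpoly (complex R) n.+1 (fun k => toC (c k)) isT.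
have [y <-] : exists y, toC y = x by exists (ofC x); case: x.
move=> Hy; exists y; apply: toC_inj; rewrite toC_pow Hy.
elim: {Hy} n => [|n IH]; first by rewrite big_ord1 toC_mul toC_pow.
by rewrite big_ord_recr IH toC_add toC_mul toC_pow.
Qed.

End ClosedField.

(** * Power series in a Banach algebra *)

Lemma half_pow_gt0 (n : nat) : 0 < (/ 2) ^ n.
Proof. apply pow_lt; lra. Qed.

Lemma half_pow_small (M eps : R) : eps > 0 ->
  exists N, forall n, (n >= N)%nat -> M * (/ 2) ^ n < eps.
Proof.
  intros He; pose proof (Rabs_pos M).
  destruct (pow_lt_1_zero (/ 2) ltac:(rewrite Rabs_pos_eq; lra)
    (eps / (Rabs M + 1)) ltac:(apply Rdiv_lt_0_compat; lra)) as [N HN].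
  exists N; intros n Hn; specialize (HN n Hn).
  pose proof (half_pow_gt0 n); rewrite Rabs_pos_eq in HN by lra.
  apply (Rmult_lt_compat_l (Rabs M + 1)) in HN; [|lra].
  replace ((Rabs M + 1) * (eps / (Rabs M + 1))) with eps in HN by (field; lra).
  pose proof (Rle_abs M); nra.
Qed.

Section FunctionalCalculus.
Variable A : BanachAlgebra.
Add Ring sqz_ring_inst : (sqz_ring A).

Lemma bnorm_0 : bnorm A 0%A = 0.
Proof.
  rewrite <- (bscal_C0 A (bzero A)), bnorm_scal, Cmod_0; ring.
Qed.

Lemma bnorm_opp (x : A) : bnorm A (- x)%A = bnorm A x.
Proof. rewrite bopp_scal, bnorm_scal, Cmod_opp, Cmod_1; ring. Qed.

Lemma bnorm_ge0 (x : A) : 0 <= bnorm A x.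
Proof.
  pose proof (bnorm_triangle A x (- x)%A) as H.
  rewrite badd_opp, bnorm_0, bnorm_opp in H; lra.
Qed.

Lemma bnorm_sub_sym (x y : A) : bnorm A (x - y)%A = bnorm A (y - x)%A.
Proof. rewrite <- bnorm_opp; f_equal; algebra. Qed.

Lemma bnorm_triangle_sub (x y z : A) :
  bnorm A (x - z)%A <= bnorm A (x - y)%A + bnorm A (y - z)%A.
Proof.
  replace (x - z)%A with ((x - y) + (y - z))%A by algebra; apply bnorm_triangle.
Qed.

Lemma bnorm_le_sub (x y : A) : bnorm A x <= bnorm A y + bnorm A (x - y)%A.
Proof.
  replace x with (y + (x - y))%A at 1 by algebra; apply bnorm_triangle.
Qed.

Lemma bsub_eq0 (x y : A) : (x - y = 0)%A -> x = y.
Proof. intros H; replace x with ((x - y) + y)%A by algebra; rewrite H; apply badd_0. Qed.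

(** The unit is not assumed to have norm 1, hence the factor [bnorm A 1], which recurs in all later
    bounds. *)
Lemma bpow_norm (a : A) (n : nat) :
  bnorm A (bpow A a n) <= bnorm A 1%A * bnorm A a ^ n.
Proof.
  induction n as [|n IH]; simpl; [lra|].
  eapply Rle_trans; [apply bnorm_submult|].
  pose proof (bnorm_ge0 a); nra.
Qed.

Definition bconv (u : nat -> A) (l : A) : Prop :=
  forall eps, eps > 0 -> exists N, forall n, (n >= N)%nat -> bnorm A (u n - l)%A < eps.

Lemma bconv_ext (u v : nat -> A) (l : A) :
  (forall n, u n = v n) -> bconv u l -> bconv v l.
Proof.
  intros E H eps He; destruct (H eps He) as [N HN].
  exists N; intros n Hn; rewrite <- E; auto.
Qed.

Lemma bconv_geometric (u : nat -> A) (l : A) (M : R) :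
  (forall n, bnorm A (u n - l)%A <= M * (/ 2) ^ n) -> bconv u l.
Proof.
  intros H eps He; destruct (half_pow_small M eps He) as [N HN].
  exists N; intros n Hn; eapply Rle_lt_trans; [apply H|auto].
Qed.

Lemma bconv_norm (u : nat -> A) (x l : A) (B : R) (m : nat) :
  bconv u l -> (forall n, (n >= m)%nat -> bnorm A (u n - x)%A <= B) ->
  bnorm A (x - l)%A <= B.
Proof.
  intros Hu HB; apply le_epsilon; intros eps He.
  destruct (Hu eps He) as [N HN].
  specialize (HN (N + m)%nat ltac:(lia)); specialize (HB (N + m)%nat ltac:(lia)).
  pose proof (bnorm_triangle_sub x (u (N + m)%nat) l) as H.
  rewrite bnorm_sub_sym in HB; lra.
Qed.

Lemma bconv_unique (u : nat -> A) (l l' : A) : bconv u l -> bconv u l' -> l = l'.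
Proof.
  intros Hl Hl'; apply bsub_eq0, bnorm_eq0.
  apply Rle_antisym; [|apply bnorm_ge0].
  apply le_epsilon; intros eps He; rewrite Rplus_0_l.
  destruct (Hl eps He) as [N HN].
  apply (bconv_norm u l l' eps N Hl').
  intros n Hn; left; auto.
Qed.

Lemma bconv_add (u v : nat -> A) (l l' : A) :
  bconv u l -> bconv v l' -> bconv (fun n => u n + v n)%A (l + l')%A.
Proof.
  intros Hu Hv eps He.
  destruct (Hu (eps / 2) ltac:(lra)) as [N HN].
  destruct (Hv (eps / 2) ltac:(lra)) as [N' HN'].
  exists (N + N')%nat; intros n Hn.
  specialize (HN n ltac:(lia)); specialize (HN' n ltac:(lia)).
  replace (u n + v n - (l + l'))%A with ((u n - l) + (v n - l'))%A by algebra.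
  eapply Rle_lt_trans; [apply bnorm_triangle|lra].
Qed.

Lemma bconv_mull (x : A) (u : nat -> A) (l : A) :
  bconv u l -> bconv (fun n => x * u n)%A (x * l)%A.
Proof.
  intros Hu eps He; pose proof (bnorm_ge0 x).
  destruct (Hu (eps / (bnorm A x + 1)) ltac:(apply Rdiv_lt_0_compat; lra)) as [N HN].
  exists N; intros n Hn; specialize (HN n Hn).
  replace (x * u n - x * l)%A with (x * (u n - l))%A by algebra.
  eapply Rle_lt_trans; [apply bnorm_submult|].
  apply (Rmult_lt_compat_l (bnorm A x + 1)) in HN; [|lra].
  replace ((bnorm A x + 1) * (eps / (bnorm A x + 1))) with eps in HN by (field; lra).
  pose proof (bnorm_ge0 (u n - l)%A); nra.
Qed.

Lemma bconv_const (x : A) : bconv (fun _ => x) x.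
Proof. intros eps He; exists 0%nat; intros; rewrite badd_opp, bnorm_0; lra. Qed.

Lemma bsum_0 (f : nat -> A) : bsum A f 0 = f 0%nat.
Proof. apply badd_0r. Qed.

Lemma fold_right_badd (f : nat -> A) (s : list nat) (x : A) :
  fold_right (fun k acc => f k + acc)%A x s =
  (fold_right (fun k acc => f k + acc)%A (bzero A) s + x)%A.
Proof.
  induction s as [|k s IH]; simpl; [now rewrite badd_0|].
  rewrite IH; apply badd_assoc.
Qed.

Lemma bsum_S (f : nat -> A) (n : nat) : bsum A f (S n) = (bsum A f n + f (S n))%A.
Proof.
  unfold bsum; rewrite seq_S, fold_right_app, fold_right_badd; simpl.
  now rewrite badd_0r.
Qed.

Lemma bsum_ext (f g : nat -> A) (n : nat) :
  (forall k, (k <= n)%nat -> f k = g k) -> bsum A f n = bsum A g n.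
Proof.
  intros H; induction n as [|n IH]; [rewrite !bsum_0; apply H; lia|].
  rewrite !bsum_S, IH by (intros; apply H; lia); f_equal; apply H; lia.
Qed.

Definition psum (c : nat -> Cplx) (a : A) : nat -> A :=
  bsum A (fun k => c k *: bpow A a k)%A.

Lemma psum_0 (c : nat -> Cplx) (a : A) : psum c a 0 = (c 0%nat *: 1)%A.
Proof. apply bsum_0. Qed.

Lemma psum_S (c : nat -> Cplx) (a : A) (n : nat) :
  psum c a (S n) = (psum c a n + c (S n) *: (a * bpow A a n))%A.
Proof. apply bsum_S. Qed.

Lemma fcalc_bconv (c : nat -> Cplx) (a x : A) : fcalc A c a x <-> bconv (psum c a) x.
Proof. reflexivity. Qed.

(** This bound is always used at elements of norm at most [r / 2], where the terms decay like powers
    of 1/2; no radius of convergence has to be carried along. *)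
Definition coef_bound (c : nat -> Cplx) (r M : R) : Prop :=
  forall k, Cmod (c k) * r ^ k <= M.

Section Geometric.
Variables (c : nat -> Cplx) (a : A) (r M : R).
Hypotheses (Hr : 0 < r) (HM : coef_bound c r M) (Ha : bnorm A a <= r / 2).

Lemma term_norm (k : nat) :
  bnorm A (c k *: bpow A a k)%A <= M * bnorm A 1%A * (/ 2) ^ k.
Proof.
  rewrite bnorm_scal.
  pose proof (bpow_norm a k) as H; pose proof (HM k) as H'.
  pose proof (Cmod_ge0 (c k)); pose proof (bnorm_ge0 1%A); pose proof (bnorm_ge0 a).
  assert (Hq : bnorm A a ^ k <= r ^ k * (/ 2) ^ k).
  { rewrite <- Rpow_mult_distr; apply pow_incr; lra. }
  pose proof (half_pow_gt0 k); pose proof (pow_lt r k Hr).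
  apply Rle_trans with (Cmod (c k) * (bnorm A 1%A * (r ^ k * (/ 2) ^ k))).
  - apply Rmult_le_compat_l; [lra|].
    eapply Rle_trans; [exact H|]; now apply Rmult_le_compat_l.
  - replace (Cmod (c k) * (bnorm A 1%A * (r ^ k * (/ 2) ^ k)))
      with (Cmod (c k) * r ^ k * (bnorm A 1%A * (/ 2) ^ k)) by ring.
    rewrite (Rmult_assoc M); apply Rmult_le_compat_r; [nra|exact H'].
Qed.

(** The difference of powers is the exact sum of the geometric terms from [m + 1] to [m + j]; a
    bound by [(/ 2) ^ m] alone would not survive the induction on [j]. *)
Lemma psum_cauchy (m j : nat) :
  bnorm A (psum c a (m + j) - psum c a m)%A <=
  M * bnorm A 1%A * ((/ 2) ^ m - (/ 2) ^ (m + j)).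
Proof.
  induction j as [|j IH].
  - rewrite Nat.add_0_r, badd_opp, bnorm_0; lra.
  - rewrite Nat.add_succ_r, psum_S.
    pose proof (term_norm (S (m + j))) as H; cbn [bpow] in H.
    set (x := psum c a (m + j)) in *; set (t := (c (S (m + j)) *: _)%A) in *.
    replace (x + t - psum c a m)%A with ((x - psum c a m) + t)%A by algebra.
    eapply Rle_trans; [apply bnorm_triangle|].
    simpl pow in *; lra.
Qed.

Lemma psum_bound_ge0 : 0 <= M * bnorm A 1%A.
Proof.
  pose proof (term_norm 0); pose proof (bnorm_ge0 (c 0%nat *: bpow A a 0)%A).
  simpl in *; lra.
Qed.

Lemma psum_dist (m n : nat) : (n >= m)%nat ->
  bnorm A (psum c a n - psum c a m)%A <= M * bnorm A 1%A * (/ 2) ^ m.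
Proof.
  intros H; replace n with (m + (n - m))%nat by lia.
  eapply Rle_trans; [apply psum_cauchy|].
  pose proof psum_bound_ge0; pose proof (half_pow_gt0 (m + (n - m))).
  apply Rmult_le_compat_l; lra.
Qed.

Lemma fcalc_ex : exists x, fcalc A c a x.
Proof.
  apply bcomplete; intros eps He.
  destruct (half_pow_small (M * bnorm A 1%A) (eps / 2) ltac:(lra)) as [N HN].
  exists N; intros m n Hm Hn.
  pose proof (psum_dist N m Hm); pose proof (psum_dist N n Hn).
  specialize (HN N (le_n N)).
  fold (psum c a m) (psum c a n).
  change (bnorm A (psum c a m - psum c a n)%A < eps).
  pose proof (bnorm_triangle_sub (psum c a m) (psum c a N) (psum c a n)).
  rewrite (bnorm_sub_sym (psum c a N)) in *; lra.
Qed.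

Lemma fcalc_dist (x : A) (m : nat) : fcalc A c a x ->
  bnorm A (psum c a m - x)%A <= M * bnorm A 1%A * (/ 2) ^ m.
Proof.
  intros H; apply (bconv_norm _ _ _ _ m H); intros n Hn; now apply psum_dist.
Qed.

Lemma fcalc_norm (x : A) : fcalc A c a x -> bnorm A x <= 2 * (M * bnorm A 1%A).
Proof.
  intros H; pose proof (fcalc_dist x 0 H) as H1.
  pose proof (term_norm 0) as H2; pose proof (bnorm_le_sub x (psum c a 0)) as H3.
  rewrite bnorm_sub_sym in H3.
  rewrite (psum_0 c a) in *; simpl in *; lra.
Qed.

End Geometric.

(* [c = w + (X - lam) d] as formal power series. *)
Definition linear_factor (c : nat -> Cplx) (w lam : Cplx) (d : nat -> Cplx) : Prop :=
  c 0%nat = (w - lam * d 0%nat)%C /\ forall k, c (S k) = (d k - lam * d (S k))%C.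

(** Multiplying the truncation of [d] by [a - lam] produces one term of degree [n + 1] too many,
    which is subtracted. It tends to 0 under a coefficient bound on [d], and this yields the
    factorization of the full series. *)
Lemma psum_factor (c d : nat -> Cplx) (w lam : Cplx) (a : A) (n : nat) :
  linear_factor c w lam d ->
  psum c a n = (w *: 1 + (a - lam *: 1) * psum d a n - d n *: (a * bpow A a n))%A.
Proof.
  intros [H0 HS]; induction n as [|n IH].
  - rewrite !psum_0, H0; simpl; algebra.
  - rewrite !psum_S, IH, HS; cbn [bpow]; algebra.
Qed.

Lemma psum_comm (c : nat -> Cplx) (a : A) (n : nat) :
  (a * psum c a n = psum c a n * a)%A.
Proof.
  assert (Hp : forall k, (a * bpow A a k = bpow A a k * a)%A).
  { induction k as [|k IH]; simpl; [algebra|].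
    rewrite IH at 1; apply bmul_assoc. }
  induction n as [|n IH]; [rewrite psum_0; algebra|].
  rewrite psum_S, bmul_addl, bmul_addr, IH; f_equal.
  rewrite bmul_scall, bmul_scalr, bmul_assoc_r, <- Hp; reflexivity.
Qed.

Lemma fcalc_factor (c d : nat -> Cplx) (w lam : Cplx) (a y : A) (r M : R) :
  0 < r -> coef_bound d r M -> bnorm A a <= r / 2 ->
  linear_factor c w lam d -> fcalc A d a y ->
  fcalc A c a (w *: 1 + (a - lam *: 1) * y)%A.
Proof.
  intros Hr HM Ha Hf Hy.
  apply fcalc_bconv, (bconv_ext (fun n =>
    (w *: 1 + (a - lam *: 1) * psum d a n) + - a * (d n *: bpow A a n))%A).
  { intros n; rewrite (psum_factor c d w lam a n Hf); algebra. }
  replace (w *: 1 + (a - lam *: 1) * y)%A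
    with ((w *: 1 + (a - lam *: 1) * y) + - a * 0)%A by algebra.
  apply bconv_add; [apply bconv_add|].
  - apply bconv_const.
  - now apply bconv_mull.
  - apply bconv_mull, (bconv_geometric _ _ (M * bnorm A 1%A)); intros n.
    replace (d n *: bpow A a n - 0)%A with (d n *: bpow A a n)%A by algebra.
    now apply (term_norm d a r M).
Qed.

End FunctionalCalculus.

(** * Division of entire series by linear factors *)

Section Shift.
Variable A : BanachAlgebra.
Add Ring sqz_ring_inst : (sqz_ring A).

Lemma psum_shift (c : nat -> Cplx) (a : A) (n : nat) :
  psum A c a (S n) = (c 0%nat *: 1 + a * psum A (fun j => c (S j)) a n)%A.
Proof.
  induction n as [|n IH].
  - rewrite psum_S, !psum_0; simpl; algebra.
  - rewrite psum_S, IH, psum_S; cbn [bpow]; algebra.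
Qed.

Lemma psum_ext (c d : nat -> Cplx) (a : A) (n : nat) :
  (forall k, (k <= n)%nat -> c k = d k) -> psum A c a n = psum A d a n.
Proof. intros H; apply bsum_ext; intros k Hk; now rewrite H. Qed.

Lemma fcalc_ext (c d : nat -> Cplx) (a x : A) :
  (forall k, c k = d k) -> fcalc A c a x -> fcalc A d a x.
Proof. intros H; apply bconv_ext; intros n; apply psum_ext; auto. Qed.

Lemma fcalc_shift (c : nat -> Cplx) (a x : A) :
  fcalc A (fun j => c (S j)) a x -> fcalc A c a (c 0%nat *: 1 + a * x)%A.
Proof.
  intros H eps He.
  destruct (bconv_add A _ _ _ _ (bconv_const A (c 0%nat *: 1)%A) (bconv_mull A a _ _ H)
    eps He) as [N HN].
  exists (S N); intros [|n] Hn; [lia|].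
  change (bnorm A (psum A c a (S n) - (c 0%nat *: 1 + a * x))%A < eps).
  rewrite psum_shift; apply HN; lia.
Qed.

End Shift.

(** * Complex series as the scalar case, and entire functions *)

Lemma Cauchy_Re_Im (u : nat -> Cplx) (f : Cplx -> R) :
  (forall z, Rabs (f z) <= Cmod z) -> (forall z w, f (z - w)%C = f z - f w) ->
  (forall eps, eps > 0 -> exists N, forall m n, (m >= N)%nat -> (n >= N)%nat ->
        Cmod (u m - u n)%C < eps) ->
  exists l, forall eps, eps > 0 -> exists N, forall n, (n >= N)%nat -> Rabs (f (u n) - l) < eps.
Proof.
  intros Hf Hsub Hu.
  destruct (R_complete (fun n => f (u n))) as [l Hl].
  - intros eps He; destruct (Hu eps He) as [N HN]; exists N; intros m n Hm Hn.
    unfold Rdist; rewrite <- Hsub; eapply Rle_lt_trans; [apply Hf|auto].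
  - now exists l.
Qed.

Lemma Cplx_complete (u : nat -> Cplx) :
  (forall eps, eps > 0 -> exists N, forall m n, (m >= N)%nat -> (n >= N)%nat ->
        Cmod (u m - u n)%C < eps) ->
  exists l, forall eps, eps > 0 -> exists N, forall n, (n >= N)%nat ->
        Cmod (u n - l)%C < eps.
Proof.
  intros Hu.
  destruct (Cauchy_Re_Im u Re Re_le_Cmod ltac:(reflexivity) Hu) as [x Hx].
  destruct (Cauchy_Re_Im u Im Im_le_Cmod ltac:(reflexivity) Hu) as [y Hy].
  exists (mkC x y); intros eps He.
  destruct (Hx (eps / 2) ltac:(lra)) as [N HN].
  destruct (Hy (eps / 2) ltac:(lra)) as [N' HN'].
  exists (N + N')%nat; intros n Hn.
  specialize (HN n ltac:(lia)); specialize (HN' n ltac:(lia)).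
  pose proof (Cmod_le_Re_Im (u n - mkC x y)%C) as H; simpl in H.
  unfold Rminus in *; lra.
Qed.

(** Scalar series become the case of this algebra, so convergence, factorization and bounds need not
    be proved twice. The definition is transparent so that its norm and operations compute to those
    of [Cplx]. *)
Definition CplxBA : BanachAlgebra.
Proof.
  refine {| car := Cplx; bzero := C0; bone := C1; badd := Cadd; bopp := Copp;
            bmul := Cmul; bscal := Cmul; bnorm := Cmod |};
    try (intros; ring).
  - apply Cmod_eq0.
  - apply Cmod_triangle.
  - apply Cmod_mul.
  - intros; now rewrite Cmod_mul; apply Rle_refl.
  - apply Cplx_complete.
Defined.

Definition cpsum (c : nat -> Cplx) (z : Cplx) (n : nat) : Cplx := psum CplxBA c z n.

Lemma bpow_Cpow (z : Cplx) (n : nat) : bpow CplxBA z n = Cpow z n.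
Proof. induction n as [|n IH]; simpl; [|rewrite IH]; reflexivity. Qed.

Lemma cpsum_Csum (c : nat -> Cplx) (z : Cplx) (n : nat) :
  cpsum c z n = Csum (fun k => Cmul (c k) (Cpow z k)) n.
Proof.
  unfold cpsum; induction n as [|n IH].
  - apply (psum_0 CplxBA).
  - rewrite psum_S, IH; simpl; now rewrite bpow_Cpow.
Qed.

Lemma cpsum_S (c : nat -> Cplx) (z : Cplx) (n : nat) :
  cpsum c z (S n) = (cpsum c z n + c (S n) * Cpow z (S n))%C.
Proof. now rewrite !cpsum_Csum. Qed.

Definition has_value (c : nat -> Cplx) (z w : Cplx) : Prop := fcalc CplxBA c z w.

Lemma ps_conv_has_value (c : nat -> Cplx) (z w : Cplx) : ps_conv c z w -> has_value c z w.
Proof.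
  apply (bconv_ext CplxBA); intros n; symmetry; apply cpsum_Csum.
Qed.

Lemma has_value_unique (c : nat -> Cplx) (z w w' : Cplx) :
  has_value c z w -> has_value c z w' -> w = w'.
Proof. apply (bconv_unique CplxBA). Qed.

Definition entire (c : nat -> Cplx) : Prop :=
  forall r, 0 < r -> exists M, coef_bound c r M.

Lemma eventually_bounded (f : nat -> R) (N : nat) (B : R) :
  (forall n, (n >= N)%nat -> f n <= B) -> exists M, forall n, f n <= M.
Proof.
  revert B; induction N as [|N IH]; intros B H; [exists B; intros; apply H; lia|].
  apply (IH (Rmax B (f N))); intros n Hn.
  destruct (Nat.eq_dec n N) as [->|]; [apply Rmax_r|].
  eapply Rle_trans; [apply H; lia|apply Rmax_l].
Qed.

Lemma everywhere_convergent_entire (c : nat -> Cplx) :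
  (forall z, exists w, has_value c z w) -> entire c.
Proof.
  intros H r Hr; destruct (H (RtoC r)) as [w Hw].
  destruct (Hw 1 ltac:(lra)) as [N HN].
  (* Beyond index [N] a term is the difference of two partial sums, each within 1 of the limit, so
     its modulus is at most 2. *)
  apply (eventually_bounded _ (S N) 2); intros [|n] Hn; [lia|].
  pose proof (HN n ltac:(lia)) as H1; pose proof (HN (S n) ltac:(lia)) as H2.
  change (Cmod (cpsum c (RtoC r) n - w)%C < 1) in H1.
  change (Cmod (cpsum c (RtoC r) (S n) - w)%C < 1) in H2.
  rewrite cpsum_S in H2.
  pose proof (Cmod_triangle_inv (c (S n) * Cpow (RtoC r) (S n)) (- (cpsum c (RtoC r) n - w)))%C as H3.
  rewrite Cmod_opp, Cmod_mul, Cmod_pow, Cmod_RtoC, Rabs_pos_eq in H3 by lra.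
  match type of H3 with _ <= Cmod ?x => 
    replace x with (cpsum c (RtoC r) n + c (S n) * Cpow (RtoC r) (S n) - w)%C in H3 by ring end.
  lra.
Qed.

Lemma has_value_ex (c : nat -> Cplx) (z : Cplx) : entire c -> exists w, has_value c z w.
Proof.
  intros H; pose proof (Cmod_ge0 z).
  destruct (H (2 * Cmod z + 1) ltac:(lra)) as [M HM].
  apply (fcalc_ex CplxBA c z (2 * Cmod z + 1) M); [lra|assumption|simpl; lra].
Qed.

(** Made total by choice: the value is unspecified where the series diverges, so it is used for
    entire series only. *)
Definition cval (c : nat -> Cplx) (z : Cplx) : Cplx := epsilon (inhabits C0) (has_value c z).

Lemma cvalP (c : nat -> Cplx) (z : Cplx) : entire c -> has_value c z (cval c z).
Proof. intros H; unfold cval; apply epsilon_spec, has_value_ex, H. Qed.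

Lemma cval_eq (c : nat -> Cplx) (z w : Cplx) : entire c -> has_value c z w -> cval c z = w.
Proof. intros H; apply has_value_unique, cvalP, H. Qed.

Lemma fcalc_entire_ex (A : BanachAlgebra) (c : nat -> Cplx) (a : A) :
  entire c -> exists x, fcalc A c a x.
Proof.
  intros H; pose proof (bnorm_ge0 A a).
  destruct (H (2 * bnorm A a + 1) ltac:(lra)) as [M HM].
  apply (fcalc_ex A c a (2 * bnorm A a + 1) M); [lra|assumption|lra].
Qed.

(* The coefficients of the quotient of [c - c(lam)] by [X - lam] are the
   values at [lam] of the shifted series. *)
Lemma linear_factor_ex (c : nat -> Cplx) (lam : Cplx) : entire c ->
  exists d, linear_factor c (cval c lam) lam d /\
    forall r M, 0 < r -> Cmod lam <= r / 2 -> coef_bound c r M ->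
      coef_bound d r (2 * M / r).
Proof.
  intros Hc.
  assert (Hsh : forall k r M, 0 < r -> coef_bound c r M ->
    coef_bound (fun j => c (j + S k)%nat) r (M / r ^ S k)).
  { intros k r M Hr HM j; pose proof (pow_lt r (S k) Hr).
    apply (Rmult_le_reg_r (r ^ S k)); [lra|].
    replace (M / r ^ S k * r ^ S k) with M by (field; lra).
    rewrite Rmult_assoc, <- pow_add; apply HM. }
  assert (He : forall k, entire (fun j => c (j + S k)%nat)).
  { intros k r Hr; destruct (Hc r Hr) as [M HM]; eexists; apply (Hsh k r M Hr HM). }
  set (d := fun k => cval (fun j => c (j + S k)%nat) lam).
  assert (Hd : forall k, has_value (fun j => c (j + S k)%nat) lam (d k)).
  { intros k; apply cvalP, He. }
  exists d; split; [split|].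
  - assert (E : cval c lam = (c 0%nat * C1 + lam * d 0%nat)%C).
    { apply cval_eq; [exact Hc|]; apply (fcalc_shift CplxBA).
      apply (fcalc_ext CplxBA _ _ _ _) with (2 := Hd 0%nat).
      intros j; f_equal; lia. }
    rewrite E; ring.
  - intros k; assert (E : d k = (c (S k) * C1 + lam * d (S k))%C).
    { apply (has_value_unique _ lam _ _ (Hd k)).
      apply (fcalc_shift CplxBA (fun j => c (j + S k)%nat)).
      apply (fcalc_ext CplxBA _ _ _ _) with (2 := Hd (S k)).
      intros j; f_equal; lia. }
    rewrite E; ring.
  (* The series shifted by [S k] has the bound [M / r ^ S k], and summing it on the half disc
     doubles the bound; this is the origin of [2 * M / r]. *)
  - intros r M Hr Hlam HM k.
    pose proof (fcalc_norm CplxBA _ lam r _ Hr (Hsh k r M Hr HM) Hlam _ (Hd k)) as H.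
    simpl bnorm in H; rewrite Cmod_1 in H.
    pose proof (pow_lt r k Hr).
    apply Rle_trans with (2 * (M / r ^ S k * 1) * r ^ k).
    + apply Rmult_le_compat_r; lra.
    + right; simpl; field; lra.
Qed.

Lemma entire_quotient (c d : nat -> Cplx) (lam : Cplx) : entire c ->
  (forall r M, 0 < r -> Cmod lam <= r / 2 -> coef_bound c r M ->
      coef_bound d r (2 * M / r)) -> entire d.
Proof.
  intros Hc Hd r Hr; pose proof (Cmod_ge0 lam).
  (* The radius is enlarged to put [lam] in its half disc; a coefficient bound at a larger radius
     implies one at [r]. *)
  destruct (Hc (r + 2 * Cmod lam) ltac:(lra)) as [M HM].
  specialize (Hd (r + 2 * Cmod lam) M ltac:(lra) ltac:(lra) HM).
  eexists; intros k; eapply Rle_trans; [|apply Hd].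
  apply Rmult_le_compat_l; [apply Cmod_ge0|apply pow_incr; lra].
Qed.

Lemma cval_factor (c d : nat -> Cplx) (w lam z : Cplx) :
  entire c -> entire d -> linear_factor c w lam d ->
  cval c z = (w + (z - lam) * cval d z)%C.
Proof.
  intros Hc Hd Hf; pose proof (Cmod_ge0 z).
  destruct (Hd (2 * Cmod z + 1) ltac:(lra)) as [M HM].
  assert (E : cval c z = (w * C1 + (z + - (lam * C1)) * cval d z)%C).
  { apply cval_eq; [exact Hc|].
    apply (fcalc_factor CplxBA c d w lam z (cval d z) (2 * Cmod z + 1) M);
      [lra|assumption|simpl; lra|assumption|apply cvalP, Hd]. }
  rewrite E; ring.
Qed.

(** The quotient of [c - c(w)] by [X - w] has coefficients bounded at radius [2 * r] independently
    of [w], hence values bounded uniformly on the disc of radius [r]. No derivative of [c] is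
    involved. *)
Lemma cval_lipschitz (c : nat -> Cplx) (r : R) : 0 < r -> entire c ->
  exists K, 0 <= K /\ forall z w, Cmod z <= r -> Cmod w <= r ->
    Cmod (cval c z - cval c w)%C <= K * Cmod (z - w)%C.
Proof.
  intros Hr Hc; destruct (Hc (2 * r) ltac:(lra)) as [M HM].
  assert (HM0 : 0 <= M).
  { specialize (HM 0%nat); pose proof (Cmod_ge0 (c 0%nat)); simpl in HM; lra. }
  exists (2 * (2 * M / (2 * r))); split.
  { apply Rmult_le_pos; [lra|]; apply Rmult_le_pos; [lra|].
    left; apply Rinv_0_lt_compat; lra. }
  intros z w Hz Hw.
  destruct (linear_factor_ex c w Hc) as [d [Hf Hd]].
  pose proof (entire_quotient c d w Hc Hd) as Hde.
  specialize (Hd (2 * r) M ltac:(lra) ltac:(lra) HM).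
  rewrite (cval_factor c d (cval c w) w z Hc Hde Hf).
  replace (cval c w + (z - w) * cval d z - cval c w)%C with ((z - w) * cval d z)%C by ring.
  rewrite Cmod_mul, Rmult_comm; apply Rmult_le_compat_r; [apply Cmod_ge0|].
  pose proof (fcalc_norm CplxBA d z (2 * r) _ ltac:(lra) Hd) as H.
  simpl bnorm in H; rewrite Cmod_1, Rmult_1_r in H.
  apply H; [lra|apply cvalP, Hde].
Qed.

(** * Cauchy estimate *)

Definition cis (t : R) : Cplx := mkC (cos t) (sin t).

Lemma cis_add (s t : R) : cis (s + t) = (cis s * cis t)%C.
Proof. apply Cplx_ext; simpl; [apply cos_plus|rewrite sin_plus; ring]. Qed.

Lemma cis_mul (t : R) (n : nat) : cis (INR n * t) = Cpow (cis t) n.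
Proof.
  induction n as [|n IH].
  - rewrite Rmult_0_l; apply Cplx_ext; simpl; [apply cos_0|apply sin_0].
  - rewrite S_INR, Rmult_plus_distr_r, Rmult_1_l, Rplus_comm, cis_add, IH; reflexivity.
Qed.

Lemma Cmod_cis (t : R) : Cmod (cis t) = 1.
Proof.
  unfold Cmod; simpl; pose proof (sin2_cos2 t) as H; unfold Rsqr in H.
  rewrite Rplus_comm, H; apply sqrt_1.
Qed.

Lemma Cpow_add (z : Cplx) (m n : nat) : Cpow z (m + n) = (Cpow z m * Cpow z n)%C.
Proof. induction m as [|m IH]; simpl; [|rewrite IH]; ring. Qed.

Lemma Cpow_mul_distr (z w : Cplx) (n : nat) : Cpow (z * w)%C n = (Cpow z n * Cpow w n)%C.
Proof. induction n as [|n IH]; simpl; [|rewrite IH]; ring. Qed.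

Lemma Cpow_mult (z : Cplx) (m n : nat) : Cpow z (m * n) = Cpow (Cpow z m) n.
Proof.
  induction n as [|n IH]; [now rewrite Nat.mul_0_r|].
  rewrite Nat.mul_succ_r, Cpow_add, IH; simpl; ring.
Qed.

Lemma Cpow_1 (n : nat) : Cpow C1 n = C1.
Proof. induction n as [|n IH]; simpl; [|rewrite IH]; ring. Qed.

Lemma cis_neq1 (t : R) : t <> 0 -> - (2 * PI) < t < 2 * PI -> cis t <> C1.
Proof.
  intros H0 Ht H; injection H; intros Hs Hc.
  assert (E : cos t = 1 - 2 * sin (t / 2) * sin (t / 2)).
  { rewrite <- cos_2a_sin; f_equal; lra. }
  destruct (Rtotal_order t 0) as [Hn|[Hz|Hp]]; [|lra|].
  - pose proof (sin_lt_0_var (t / 2) ltac:(lra) ltac:(lra)); nra.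
  - pose proof (sin_gt_0 (t / 2) ltac:(lra) ltac:(lra)); nra.
Qed.

Lemma Csum_S (f : nat -> Cplx) (n : nat) : Csum f (S n) = (Csum f n + f (S n))%C.
Proof. reflexivity. Qed.

Lemma Csum_ext (f g : nat -> Cplx) (n : nat) :
  (forall k, (k <= n)%nat -> f k = g k) -> Csum f n = Csum g n.
Proof.
  intros H; induction n as [|n IH]; simpl; [apply H; lia|].
  rewrite IH by (intros; apply H; lia); f_equal; apply H; lia.
Qed.

Lemma Csum_add (f g : nat -> Cplx) (n : nat) :
  Csum (fun k => f k + g k)%C n = (Csum f n + Csum g n)%C.
Proof. induction n as [|n IH]; simpl; [|rewrite IH; ring]; reflexivity. Qed.

Lemma Csum_mull (x : Cplx) (f : nat -> Cplx) (n : nat) :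
  Csum (fun k => x * f k)%C n = (x * Csum f n)%C.
Proof. induction n as [|n IH]; simpl; [|rewrite IH; ring]; reflexivity. Qed.

Lemma Csum_0 (n : nat) : Csum (fun _ => C0) n = C0.
Proof. induction n as [|n IH]; simpl; [|rewrite IH; ring]; reflexivity. Qed.

Lemma Csum_swap (f : nat -> nat -> Cplx) (m n : nat) :
  Csum (fun i => Csum (f i) n) m = Csum (fun j => Csum (fun i => f i j) m) n.
Proof.
  induction m as [|m IH]; simpl; [reflexivity|].
  now rewrite IH, <- Csum_add.
Qed.

Lemma Csum_single (f : nat -> Cplx) (k n : nat) : (k <= n)%nat ->
  (forall i, (i <= n)%nat -> i <> k -> f i = C0) -> Csum f n = f k.
Proof.
  intros Hk H; induction n as [|n IH].
  - now replace k with 0%nat by lia.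
  - rewrite Csum_S; destruct (Nat.eq_dec k (S n)) as [->|Hne].
    + rewrite (Csum_ext _ (fun _ => C0)), Csum_0 by (intros; apply H; lia); ring.
    + rewrite IH, (H (S n)) by (try lia; intros; apply H; lia); ring.
Qed.

Lemma Cmod_Csum_le (f : nat -> Cplx) (B : R) (n : nat) :
  (forall k, (k <= n)%nat -> Cmod (f k) <= B) -> Cmod (Csum f n) <= INR (S n) * B.
Proof.
  intros H; induction n as [|n IH].
  - simpl; rewrite Rmult_1_l; apply H; lia.
  - rewrite Csum_S, S_INR; eapply Rle_trans; [apply Cmod_triangle|].
    specialize (IH ltac:(intros; apply H; lia)); specialize (H (S n) ltac:(lia)); lra.
Qed.

Lemma geometric_Csum (x : Cplx) (n : nat) :
  ((x - C1) * Csum (Cpow x) n = Cpow x (S n) - C1)%C.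
Proof.
  induction n as [|n IH]; [simpl; ring|].
  rewrite Csum_S.
  replace ((x - C1) * (Csum (Cpow x) n + Cpow x (S n)))%C
    with ((x - C1) * Csum (Cpow x) n + (x - C1) * Cpow x (S n))%C by ring.
  rewrite IH; simpl; ring.
Qed.

Lemma root_of_unity_sum (x : Cplx) (n : nat) :
  x <> C1 -> Cpow x (S n) = C1 -> Csum (Cpow x) n = C0.
Proof.
  intros Hx H1; pose proof (geometric_Csum x n) as E.
  rewrite H1 in E; replace (C1 - C1)%C with C0 in E by ring.
  destruct (Cmul_eq0 _ _ E) as [E'|E']; [|exact E'].
  exfalso; apply Hx, Csub_eq0, E'.
Qed.

Lemma Csum_1 (n : nat) : Csum (fun _ => C1) n = RtoC (INR (S n)).
Proof.
  induction n as [|n IH]; [reflexivity|].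
  rewrite Csum_S, IH, (S_INR (S n)); apply Cplx_ext; simpl; ring.
Qed.

(* Averaging [z^-k p(z)] over the (n+1)-st roots of unity isolates [c k]. *)
Lemma cauchy_estimate_poly (c : nat -> Cplx) (n k : nat) (r B : R) :
  0 < r -> (k <= n)%nat ->
  (forall z, Cmod z = r -> Cmod (cpsum c z n) <= B) -> Cmod (c k) * r ^ k <= B.
Proof.
  intros Hr Hk HB; pose proof (lt_0_INR (S n) ltac:(lia)) as Hn; pose proof PI_RGT_0.
  set (t := 2 * PI / INR (S n)).
  assert (Ht : 0 < t) by (apply Rdiv_lt_0_compat; lra).
  assert (Hnt : INR (S n) * t = 2 * PI) by (unfold t; field; lra).
  assert (Hone : forall m, cis ((INR m - INR k) * t) =
                           (Cpow (cis (- t)) k * Cpow (cis t) m)%C).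
  { intros m; rewrite <- !cis_mul, <- cis_add; f_equal; ring. }
  assert (Hroot : forall m, Cpow (cis ((INR m - INR k) * t)) (S n) = C1).
  { assert (Hw : Cpow (cis t) (S n) = C1).
    { rewrite <- cis_mul, Hnt; apply Cplx_ext; [apply cos_2PI|apply sin_2PI]. }
    assert (Hv : Cpow (cis (- t)) (S n) = C1).
    { rewrite <- cis_mul, Ropp_mult_distr_r_reverse, Hnt; apply Cplx_ext; simpl;
        [rewrite cos_neg; apply cos_2PI|rewrite sin_neg, sin_2PI; ring]. }
    intros m; rewrite Hone, Cpow_mul_distr, <- !Cpow_mult, !(Nat.mul_comm _ (S n)).
    rewrite !Cpow_mult, Hv, Hw, !Cpow_1; ring. }
  assert (E : Csum (fun j => Cpow (Cpow (cis (- t)) k) j *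
                             cpsum c (RtoC r * Cpow (cis t) j) n)%C n =
              (RtoC (INR (S n)) * (c k * Cpow (RtoC r) k))%C).
  { rewrite (Csum_ext _ (fun j => Csum (fun m => (c m * Cpow (RtoC r) m) *
      Cpow (cis ((INR m - INR k) * t)) j) n)%C).
    2:{ intros j _; rewrite cpsum_Csum, <- Csum_mull; apply Csum_ext; intros m _.
        rewrite Hone, !Cpow_mul_distr, <- !Cpow_mult, (Nat.mul_comm j m); ring. }
    rewrite Csum_swap, (Csum_single _ k n Hk).
    - rewrite Csum_mull, (Csum_ext _ (fun _ => C1)), Csum_1; [ring|].
      intros j _; rewrite Rminus_diag, Rmult_0_l.
      replace (cis 0) with C1; [apply Cpow_1|].
      symmetry; apply Cplx_ext; [apply cos_0|apply sin_0].
    - intros m Hm Hmk; rewrite Csum_mull, root_of_unity_sum; [ring| |apply Hroot].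
      pose proof (lt_INR k (S n) ltac:(lia)); pose proof (lt_INR m (S n) ltac:(lia)).
      pose proof (pos_INR k); pose proof (pos_INR m).
      (* Distinct exponents at most [n] differ by less than [n + 1], so the angle lies strictly
         between minus and plus a full turn. *)
      apply cis_neq1; [|rewrite <- Hnt; split; nra].
      apply Rmult_integral_contrapositive; split; [|lra].
      intros Hmk'; apply Hmk, INR_eq; lra. }
  apply (f_equal Cmod) in E.
  rewrite !Cmod_mul, Cmod_pow, !Cmod_RtoC, !Rabs_pos_eq in E by lra.
  apply (Rmult_le_reg_l (INR (S n))); [exact Hn|rewrite <- E].
  apply Cmod_Csum_le; intros j _.
  rewrite Cmod_mul, !Cmod_pow, Cmod_cis, !pow1, Rmult_1_l.
  apply HB; rewrite Cmod_mul, Cmod_pow, Cmod_RtoC, Cmod_cis, pow1, Rabs_pos_eq by lra.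
  ring.
Qed.

(** The bound [M] at the double radius makes the truncations converge uniformly on the circle, so
    they are bounded there by [B + eps], and the polynomial estimate applies. The resulting bound is
    free of [M]. *)
Lemma cauchy_estimate (c : nat -> Cplx) (r M B : R) :
  0 < r -> coef_bound c (2 * r) M ->
  (forall z, Cmod z = r -> exists w, has_value c z w /\ Cmod w <= B) ->
  coef_bound c r B.
Proof.
  intros Hr HM HB k; apply le_epsilon; intros eps He.
  destruct (half_pow_small M eps He) as [N HN].
  apply (cauchy_estimate_poly c (N + k) k r); [exact Hr|lia|].
  intros z Hz; destruct (HB z Hz) as [w [Hw Hwb]].
  pose proof (fcalc_dist CplxBA c z (2 * r) M ltac:(lra) HM ltac:(simpl; lra)
    w (N + k) Hw) as H.
  pose proof (bnorm_le_sub CplxBA (cpsum c z (N + k)) w) as H'.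
  fold (cpsum c z (N + k)) in H.
  simpl bnorm in H, H'; rewrite Cmod_1, Rmult_1_r in H.
  specialize (HN (N + k)%nat ltac:(lia)); lra.
Qed.

(** * Inverses of series without zeros on a disc *)

Lemma poly_root (c : nat -> Cplx) (n : nat) :
  c (S n) <> C0 -> exists z, cpsum c z (S n) = C0.
Proof.
  intros Hc.
  destruct (monic_root n (fun k => - Cinv (c (S n)) * c k)%C) as [z Hz].
  exists z; rewrite cpsum_S, Hz.
  rewrite (Csum_ext _ (fun k => - Cinv (c (S n)) * (c k * Cpow z k))%C)
    by (intros; ring).
  rewrite Csum_mull, <- cpsum_Csum; field; exact Hc.
Qed.

(** The coefficients of the quotient are Horner's tails of [c] at [lam]; cutting them at [n] loses
    nothing, since [c] vanishes beyond degree [n + 1]. *)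
Lemma synthetic_division (c : nat -> Cplx) (n : nat) (lam : Cplx) :
  (forall k, (k > S n)%nat -> c k = C0) ->
  exists d w, (forall k, (k > n)%nat -> d k = C0) /\ linear_factor c w lam d.
Proof.
  intros Hc.
  set (d := fun k => Csum (fun j => c (S k + j)%nat * Cpow lam j)%C n).
  exists d, (c 0%nat + lam * d 0%nat)%C; split; [|split].
  - intros k Hk; unfold d; rewrite (Csum_ext _ (fun _ => C0)), Csum_0; [reflexivity|].
    intros j _; rewrite Hc by lia; ring.
  - ring.
  (* Telescoping identity for tails cut at any [m]; at [m = n] the leftover coefficient is beyond
     the degree. *)
  - assert (H : forall m k, c (S k) =
      (Csum (fun j => c (S k + j)%nat * Cpow lam j) m -
       lam * Csum (fun j => c (S (S k) + j)%nat * Cpow lam j) m +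
       c (S (S k) + m)%nat * Cpow lam (S m))%C).
    { intros m k; induction m as [|m IH].
      - simpl; rewrite !Nat.add_0_r; ring.
      - rewrite !Csum_S, IH at 1; simpl Cpow.
        replace (S k + S m)%nat with (S (S k) + m)%nat by lia; ring. }
    intros k; rewrite (H n k), (Hc (S (S k) + n)%nat) by lia.
    unfold d; ring.
Qed.

(** Induction on the degree: split off a root [lam], which lies outside the disc, and divide the
    inverse series of the cofactor by [X - lam]. A single series [e] serves all algebras, so its
    complex values are reciprocals of the polynomial and can later be estimated on a circle. *)
Lemma poly_inverse (n : nat) (c : nat -> Cplx) (r : R) : 0 < r ->
  (forall k, (k > n)%nat -> c k = C0) ->
  (forall z, Cmod z <= r -> cpsum c z n <> C0) ->
  exists e M, coef_bound e r M /\
    forall (A : BanachAlgebra) (a y : A), bnorm A a <= r / 2 -> fcalc A e a y ->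
      (psum A c a n * y = 1)%A.
Proof.
  intros Hr; revert c; induction n as [|n IH]; intros c Hc Hnz.
  - assert (H0 : c 0%nat <> C0).
    { intros H; apply (Hnz C0); [rewrite Cmod_0; lra|].
      rewrite cpsum_Csum; simpl; rewrite H; ring. }
    set (e := fun k => match k with O => Cinv (c 0%nat) | S _ => C0 end).
    exists e, (Cmod (Cinv (c 0%nat))); split.
    + intros [|k]; simpl; [lra|]; rewrite Cmod_0; pose proof (Cmod_ge0 (Cinv (c 0%nat))); lra.
    + intros A a y _ Hy.
      assert (E : y = (Cinv (c 0%nat) *: 1)%A).
      { apply (bconv_unique A (psum A e a)); [exact Hy|].
        apply (bconv_ext A (fun _ => Cinv (c 0%nat) *: 1)%A); [|apply bconv_const].
        intros m; induction m as [|m IHm]; [symmetry; apply psum_0|].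
        rewrite psum_S, <- IHm; simpl; now rewrite bscal_C0, badd_0r. }
      rewrite E, psum_0, bmul_scall, bmul_1l, bscal_assoc.
      replace (c 0%nat * Cinv (c 0%nat))%C with C1 by (field; exact H0).
      apply bscal_1.
  - destruct (classic (c (S n) = C0)) as [H0|H0].
    + assert (E : forall A a, psum A c a (S n) = psum A c a n).
      { intros A a; rewrite psum_S, H0, bscal_C0; apply badd_0r. }
      destruct (IH c) as [e [M [HM He]]].
      * intros k Hk; destruct (Nat.eq_dec k (S n)) as [->|]; [exact H0|apply Hc; lia].
      * intros z Hz; unfold cpsum; rewrite <- E; now apply Hnz.
      * exists e, M; split; [exact HM|]; intros A a y Ha Hy; rewrite E; now apply He.
    + destruct (poly_root c n H0) as [lam Hlam].
      destruct (synthetic_division c n lam Hc) as [d [w [Hd Hf]]].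
      assert (E : forall A a, psum A c a (S n) =
                    (w *: 1 + (a - lam *: 1) * psum A d a n)%A).
      { intros A a; rewrite (psum_factor A c d w lam a (S n) Hf), psum_S.
        rewrite (Hd (S n)) by lia.
        now rewrite !bscal_C0, (bopp_scal A 0%A), bscal_0, !badd_0r. }
      assert (Ew : w = C0).
      { rewrite <- Hlam; unfold cpsum; rewrite E; simpl; ring. }
      assert (Hlr : r < Cmod lam).
      { apply Rnot_le_lt; intros H; now apply (Hnz lam H). }
      subst w.
      destruct (IH d Hd) as [e [M [HM He]]].
      { intros z Hz H; apply (Hnz z Hz); unfold cpsum in *; rewrite E, H; simpl; ring. }
      assert (Hl0 : lam <> C0) by (intros ->; rewrite Cmod_0 in Hlr; lra).
      (* Solves [e = (X - lam) e'] coefficient by coefficient, starting from the constant term,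
         which is possible as [lam] is nonzero. *)
      set (e' := fix e' k := match k with
        | O => (- e 0%nat * Cinv lam)%C
        | S k => ((e' k - e (S k)) * Cinv lam)%C end).
      assert (Hf' : linear_factor e C0 lam e').
      { split; [|intros k]; simpl; field; exact Hl0. }
      (* The recursion turns a bound [K] for one coefficient into [(r * K + M) / Cmod lam] for the
         next; the constant is the fixed point of this map. *)
      assert (HM' : coef_bound e' r (M / (Cmod lam - r))).
      { assert (HMl : M / (Cmod lam - r) * (Cmod lam - r) = M) by (field; lra).
        set (K := M / (Cmod lam - r)) in *.
        destruct Hf' as [Hf0 HfS]; intros k; induction k as [|k IHk].
        - specialize (HM 0%nat); rewrite Hf0 in HM.
          replace (C0 - lam * e' 0%nat)%C with (- (lam * e' 0%nat))%C in HM by ring.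
          rewrite Cmod_opp, Cmod_mul in HM; simpl pow in *.
          pose proof (Cmod_ge0 (e' 0%nat)).
          apply (Rmult_le_reg_r (Cmod lam - r)); nra.
        - specialize (HM (S k)); specialize (HfS k).
          assert (Hm : Cmod lam * Cmod (e' (S k)) <= Cmod (e' k) + Cmod (e (S k))).
          { rewrite <- Cmod_mul, <- (Cmod_opp (e (S k))), HfS.
            replace (lam * e' (S k))%C with (e' k + - (e' k - lam * e' (S k)))%C at 1
              by ring; apply Cmod_triangle. }
          pose proof (pow_lt r k Hr); pose proof (Cmod_ge0 lam).
          assert (Hk : Cmod lam * (Cmod (e' (S k)) * r ^ S k) <= K * Cmod lam).
          { apply Rle_trans with ((Cmod (e' k) + Cmod (e (S k))) * r ^ S k).
            - rewrite <- Rmult_assoc; apply Rmult_le_compat_r; [|exact Hm].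
              simpl; nra.
            - simpl pow in *; nra. }
          apply (Rmult_le_reg_l (Cmod lam)); lra. }
      exists e', (M / (Cmod lam - r)); split; [exact HM'|].
      intros A a y Ha Hy.
      pose proof (fcalc_factor A e e' C0 lam a y r _ Hr HM' Ha Hf' Hy) as Hey.
      specialize (He A a _ Ha Hey).
      rewrite E; etransitivity; [|exact He].
      rewrite !bscal_C0, !badd_0, bmul_assoc; f_equal.
      rewrite bmul_addl, bmul_addr, psum_comm; f_equal.
      now rewrite bmul_oppl, bmul_oppr, bmul_scall, bmul_scalr, bmul_1l, bmul_1r.
Qed.

(* Bounded below on the disc, [c] is a limit of polynomials whose inverses at
   [a] are bounded uniformly, by Cauchy's estimate. *)
Lemma fcalc_cancel (A : BanachAlgebra) (a x u : A) (c : nat -> Cplx) (r delta : R) :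
  0 < r -> 0 < delta -> entire c ->
  (forall z, Cmod z <= r -> delta <= Cmod (cval c z)) ->
  bnorm A a <= r / 4 -> fcalc A c a x -> (u * x = 0)%A -> u = 0%A.
Proof.
  intros Hr Hdelta Hc Hlow Ha Hx Hux.
  destruct (Hc (2 * r) ltac:(lra)) as [M HM].
  destruct (half_pow_small M (delta / 2) ltac:(lra)) as [N HN].
  pose proof (bnorm_ge0 A 1%A) as H1.
  (* Truncations stay above [delta / 2], so their reciprocals are at most [2 / delta]. Summing a
     series with this coefficient bound at radius [r / 2] costs the outer 2 and requires norm at
     most [r / 4]. *)
  set (K := 2 * (2 / delta * bnorm A 1%A)).
  assert (HK : 0 <= K).
  { unfold K; assert (0 < 2 / delta) by (apply Rdiv_lt_0_compat; lra); nra. }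
  assert (Hinv : forall n, (n >= N)%nat ->
    exists y, (psum A c a n * y = 1)%A /\ bnorm A y <= K).
  { intros n Hn.
    set (t := fun k => if Nat.leb k n then c k else C0).
    assert (Et : forall B b, psum B t b n = psum B c b n).
    { intros B b; apply psum_ext; intros k Hk; unfold t.
      now rewrite (proj2 (Nat.leb_le k n) Hk). }
    assert (Hpn : forall z, Cmod z <= r -> delta / 2 <= Cmod (cpsum c z n)).
    { intros z Hz; specialize (Hlow z Hz).
      pose proof (fcalc_dist CplxBA c z (2 * r) M ltac:(lra) HM ltac:(simpl; lra)
        (cval c z) n (cvalP c z Hc)) as H.
      fold (cpsum c z n) in H; simpl bnorm in H; rewrite Cmod_1, Rmult_1_r in H.
      change (Cmod (cpsum c z n - cval c z)%C <= M * (/ 2) ^ n) in H.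
      rewrite Cmod_sub_sym in H; specialize (HN n Hn).
      pose proof (Cmod_triangle_inv (cval c z) (cpsum c z n)).
      pose proof (Cmod_triangle_inv (cval c z) (cval c z - cpsum c z n)%C) as H3.
      replace (cval c z - (cval c z - cpsum c z n))%C with (cpsum c z n) in H3 by ring.
      lra. }
    destruct (poly_inverse n t r Hr) as [e [M' [HM' He]]].
    { intros k Hk; unfold t; now rewrite (proj2 (Nat.leb_gt k n) Hk). }
    { intros z Hz H; specialize (Hpn z Hz); unfold cpsum in *.
      rewrite Et in H; rewrite H, Cmod_0 in Hpn; lra. }
    (* Here [M'], which depends on [n] through the roots of the truncation, is replaced by a bound
       independent of [n]. *)
    assert (Hcb : coef_bound e (r / 2) (2 / delta)).
    { apply (cauchy_estimate e (r / 2) M'); [lra|now replace (2 * (r / 2)) with r by field|].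
      intros z Hz.
      destruct (fcalc_ex CplxBA e z r M' Hr HM' ltac:(simpl; lra)) as [w Hw].
      exists w; split; [exact Hw|].
      pose proof (He CplxBA z w ltac:(simpl; lra) Hw) as E; rewrite Et in E.
      change (cpsum c z n * w = C1)%C in E.
      apply (f_equal Cmod) in E; rewrite Cmod_mul, Cmod_1 in E.
      specialize (Hpn z ltac:(lra)).
      apply (Rmult_le_reg_l (delta / 2)); [lra|].
      replace (delta / 2 * (2 / delta)) with 1 by (field; lra).
      rewrite <- E; apply Rmult_le_compat_r; [apply Cmod_ge0|exact Hpn]. }
    destruct (fcalc_ex A e a r M' Hr HM' ltac:(lra)) as [y Hy].
    exists y; split.
    - rewrite <- Et; apply He; [lra|exact Hy].
    - apply (fcalc_norm A e a (r / 2) (2 / delta)); [lra|exact Hcb|lra|exact Hy]. }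
  (* The products of [u] with the truncations at [a] tend to [u * x = 0], and [u] is recovered from
     them by right factors of norm at most [K]; a nonzero [u] would be shorter than itself. *)
  apply bnorm_eq0; destruct (bnorm_ge0 A u) as [Hu|Hu]; [exfalso|now symmetry].
  destruct (bconv_mull A u _ _ Hx (bnorm A u / (K + 1))) as [N' HN'].
  { apply Rdiv_lt_0_compat; lra. }
  destruct (Hinv (N + N')%nat ltac:(lia)) as [y [Hy HyK]].
  specialize (HN' (N + N')%nat ltac:(lia)).
  assert (E : u = ((u * psum A c a (N + N') - u * x) * y)%A).
  { rewrite Hux, bopp_scal, bscal_0, badd_0r, bmul_assoc_r, Hy; symmetry; apply bmul_1r. }
  pose proof (bnorm_submult A (u * psum A c a (N + N') - u * x)%A y) as H.
  rewrite <- E in H.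
  change (bnorm A (u * psum A c a (N + N') - u * x)%A < bnorm A u / (K + 1)) in HN'.
  set (v := bnorm A (u * psum A c a (N + N') - u * x)%A) in *.
  assert (Hv : v * (K + 1) < bnorm A u).
  { apply (Rmult_lt_compat_r (K + 1)) in HN'; [|lra].
    now replace (bnorm A u / (K + 1) * (K + 1)) with (bnorm A u) in HN' by (field; lra). }
  pose proof (bnorm_ge0 A (u * psum A c a (N + N') - u * x)%A) as Hv0; fold v in Hv0.
  nra.
Qed.

(** * Zeros *)

(** Compactness of the square of half-side [r], which contains the disc of radius [r] and lies in
    that of radius [2 * r]; this is why the centres are controlled only by [2 * r]. *)
Lemma disc_cover (r : R) (delta : Cplx -> R) :
  (forall t, Cmod t <= 2 * r -> 0 < delta t) ->
  exists l, forall z, Cmod z <= r ->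
    exists t, In t l /\ Cmod t <= 2 * r /\ Cmod (z - t)%C < delta t.
Proof.
  intros Hd.
  (* The gauge must be positive everywhere, hence the default 1. Halving turns closeness in each
     coordinate into closeness in modulus. *)
  assert (Hpos : forall t : Cplx,
    0 < if Rlt_dec 0 (delta t) then delta t / 2 else 1).
  { intros t; destruct (Rlt_dec 0 (delta t)); lra. }
  apply NNPP; intros Hn.
  apply (compactness_list 2 (- r, (- r, tt)) (r, (r, tt))
    (fun p => let '(x, (y, _)) := p in mkposreal _ (Hpos (mkC x y)))).
  intros [l Hl]; apply Hn.
  exists (map (fun p : Tn 2 R => let '(x, (y, _)) := p in mkC x y) l); intros z Hz.
  assert (Hb : forall x, Rabs x <= Cmod z -> - r <= x <= r).
  { intros x Hx; pose proof (Rle_abs x); pose proof (Rle_abs (- x)) as Hx'.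
    rewrite Rabs_Ropp in Hx'; lra. }
  pose proof (Hb _ (Re_le_Cmod z)) as HRe; pose proof (Hb _ (Im_le_Cmod z)) as HIm; clear Hb.
  destruct (Hl (Re z, (Im z, tt))) as [[x [y []]] [Ht [Hb Hc]]].
  { simpl; repeat split; lra. }
  simpl in Hb, Hc.
  assert (Ht2 : Cmod (mkC x y) <= 2 * r).
  { pose proof (Cmod_le_Re_Im (mkC x y)) as H; simpl in H.
    assert (Rabs x <= r) by (apply Rabs_le; lra).
    assert (Rabs y <= r) by (apply Rabs_le; lra); lra. }
  exists (mkC x y); split; [|split; [exact Ht2|]].
  - apply in_map_iff; exists (x, (y, tt)); auto.
  - specialize (Hd _ Ht2); destruct (Rlt_dec 0 (delta (mkC x y))); [|lra].
    pose proof (Cmod_le_Re_Im (z - mkC x y)%C) as H; simpl in H.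
    unfold Rminus in Hc; lra.
Qed.

(** At a zero the nonzero derivative dominates the increment; elsewhere the Lipschitz bound keeps
    the value away from 0. Both cases are included because the covering argument needs a radius at
    every point. *)
Lemma zero_isolated (c : nat -> Cplx) (t : Cplx) : entire c ->
  (cval c t = C0 -> exists w, w <> C0 /\ Cderiv (cval c) t w) ->
  exists delta, 0 < delta /\
    forall z, Cmod (z - t)%C < delta -> cval c z = C0 -> z = t.
Proof.
  intros Hc Hs; destruct (classic (cval c t = C0)) as [H0|H0].
  - destruct (Hs H0) as [w [Hw Hd]]; apply Cmod_gt0 in Hw.
    destruct (Hd (Cmod w / 2) ltac:(lra)) as [delta [Hdelta H]].
    exists delta; split; [exact Hdelta|]; intros z Hz Hcz.
    specialize (H (z - t)%C Hz); replace (t + (z - t))%C with z in H by ring.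
    rewrite Hcz, H0 in H.
    replace (C0 - C0 - w * (z - t))%C with (- (w * (z - t)))%C in H by ring.
    rewrite Cmod_opp, Cmod_mul in H.
    apply Csub_eq0, Cmod_eq0; pose proof (Cmod_ge0 (z - t)%C); nra.
  - apply Cmod_gt0 in H0; pose proof (Cmod_ge0 t).
    destruct (cval_lipschitz c (Cmod t + 1) ltac:(lra) Hc) as [K [HK HL]].
    exists (Rmin 1 (Cmod (cval c t) / (K + 1))); split.
    { apply Rmin_pos; [lra|apply Rdiv_lt_0_compat; lra]. }
    intros z Hz Hcz; exfalso.
    pose proof (Rmin_l 1 (Cmod (cval c t) / (K + 1))).
    pose proof (Rmin_r 1 (Cmod (cval c t) / (K + 1))).
    pose proof (Cmod_triangle_inv z t).
    specialize (HL z t ltac:(lra) ltac:(lra)).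
    rewrite Hcz in HL; replace (C0 - cval c t)%C with (- cval c t)%C in HL by ring.
    rewrite Cmod_opp in HL.
    assert (Hlt : Cmod (z - t)%C < Cmod (cval c t) / (K + 1)) by lra.
    apply (Rmult_lt_compat_r (K + 1)) in Hlt; [|lra].
    replace (Cmod (cval c t) / (K + 1) * (K + 1)) with (Cmod (cval c t)) in Hlt
      by (field; lra).
    pose proof (Cmod_ge0 (z - t)%C); nra.
Qed.

(** In a finite cover by isolating discs, a zero must be the centre of any disc that contains it.
    The list therefore consists of the centres that are zeros. *)
Lemma zeros_finite (c : nat -> Cplx) (r : R) : entire c ->
  (forall z, cval c z = C0 -> exists w, w <> C0 /\ Cderiv (cval c) z w) ->
  exists l, NoDup l /\ (forall z, In z l -> cval c z = C0) /\
    forall z, Cmod z <= r -> cval c z = C0 -> In z l.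
Proof.
  intros Hc Hs.
  set (delta := fun t => proj1_sig (constructive_indefinite_description _
    (zero_isolated c t Hc (Hs t)))).
  assert (Hdelta : forall t, 0 < delta t /\
    forall z, Cmod (z - t)%C < delta t -> cval c z = C0 -> z = t).
  { intros t; unfold delta; apply proj2_sig. }
  destruct (disc_cover r delta) as [l Hl]; [intros; apply Hdelta|].
  exists (nodup (fun x y => excluded_middle_informative (x = y))
    (filter (fun z => if excluded_middle_informative (cval c z = C0)
                      then true else false) l)).
  split; [apply NoDup_nodup|split]; intros z Hz; [|intros Hcz];
    rewrite nodup_In, filter_In in *.
  - destruct (excluded_middle_informative (cval c z = C0)); easy.
  - destruct (Hl z Hz) as [t [Ht [_ Hzt]]].
    pose proof (proj2 (Hdelta t) z Hzt Hcz); subst t; split; [exact Ht|].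
    now destruct (excluded_middle_informative (cval c z = C0)).
Qed.

(** * Removing the zeros in a disc *)

Definition lprod (A : BanachAlgebra) (a : A) (l : list Cplx) : A :=
  fold_right (fun lam y => (a - lam *: 1) * y)%A (bone A) l.

(** Dividing by [X - lam] preserves the zeros different from [lam], so distinct zeros can be removed
    in turn. *)
Lemma factor_zeros (l : list Cplx) (c : nat -> Cplx) : entire c -> NoDup l ->
  (forall z, In z l -> cval c z = C0) ->
  exists d, entire d /\ forall (A : BanachAlgebra) (a y : A),
    fcalc A d a y -> fcalc A c a (lprod A a l * y)%A.
Proof.
  revert c; induction l as [|lam l IH]; intros c Hc Hl Hz.
  - exists c; split; [exact Hc|]; intros A a y Hy; simpl; now rewrite bmul_1l.
  - inversion Hl as [|? ? Hnin Hl']; subst.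
    destruct (linear_factor_ex c lam Hc) as [d1 [Hf Hd1]].
    pose proof (entire_quotient c d1 lam Hc Hd1) as He1.
    destruct (IH d1 He1 Hl') as [d [Hd HA]].
    { intros z Hzl; pose proof (cval_factor c d1 _ lam z Hc He1 Hf) as E.
      rewrite (Hz z), (Hz lam) in E by (simpl; auto).
      assert (E' : ((z - lam) * cval d1 z)%C = C0) by (rewrite E; ring).
      destruct (Cmul_eq0 _ _ E') as [E0|E0]; [|exact E0].
      apply Csub_eq0 in E0; subst z; contradiction. }
    exists d; split; [exact Hd|]; intros A a y Hy.
    specialize (HA A a y Hy).
    pose proof (bnorm_ge0 A a).
    destruct (He1 (2 * bnorm A a + 1) ltac:(lra)) as [M HM].
    pose proof (fcalc_factor A c d1 _ lam a _ (2 * bnorm A a + 1) M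
      ltac:(lra) HM ltac:(lra) Hf HA) as E.
    rewrite (Hz lam), bscal_C0, badd_0 in E by (simpl; auto).
    simpl; now rewrite bmul_assoc_r.
Qed.

Lemma lprod_bounded (l : list Cplx) (lam : Cplx) :
  exists L, 0 <= L /\ forall u, Cmod u <= 1 -> Cmod (lprod CplxBA (lam + u)%C l) <= L.
Proof.
  induction l as [|mu l [L [HL IH]]].
  - exists 1; split; [lra|]; intros; simpl; rewrite Cmod_1; lra.
  - pose proof (Cmod_ge0 (lam - mu)%C).
    exists ((Cmod (lam - mu)%C + 1) * L); split; [nra|]; intros u Hu.
    specialize (IH u Hu); simpl; rewrite Cmod_mul.
    apply Rmult_le_compat; try apply Cmod_ge0; [|exact IH].
    replace (lam + u + - (mu * C1))%C with ((lam - mu) + u)%C by ring.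
    pose proof (Cmod_triangle (lam - mu) u)%C; lra.
Qed.

Lemma lprod_vanishes (l : list Cplx) (lam : Cplx) : In lam l ->
  exists L, 0 <= L /\ forall u, Cmod u <= 1 ->
    Cmod (lprod CplxBA (lam + u)%C l) <= L * Cmod u.
Proof.
  induction l as [|mu l IH]; [easy|]; intros [->|Hin].
  - destruct (lprod_bounded l lam) as [L [HL H]]; exists L; split; [exact HL|].
    intros u Hu; specialize (H u Hu); simpl; rewrite Cmod_mul.
    replace (lam + u + - (lam * C1))%C with u by ring.
    rewrite Rmult_comm; apply Rmult_le_compat_r; [apply Cmod_ge0|exact H].
  - destruct (IH Hin) as [L [HL H]]; pose proof (Cmod_ge0 (lam - mu)%C).
    exists ((Cmod (lam - mu)%C + 1) * L); split; [nra|]; intros u Hu.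
    specialize (H u Hu); simpl; rewrite Cmod_mul, Rmult_assoc.
    apply Rmult_le_compat; try apply Cmod_ge0; [|exact H].
    replace (lam + u + - (mu * C1))%C with ((lam - mu) + u)%C by ring.
    pose proof (Cmod_triangle (lam - mu) u)%C; lra.
Qed.

(** If [d] vanished at [lam], then [c] would be a product of two factors of order [t] at [lam + t],
    contradicting its nonzero derivative. *)
Lemma quotient_nonzero (c d : nat -> Cplx) (l : list Cplx) (lam w : Cplx) :
  entire d -> (forall z, cval c z = lprod CplxBA z l * cval d z)%C ->
  In lam l -> w <> C0 -> Cderiv (cval c) lam w -> cval d lam <> C0.
Proof.
  intros Hd E Hin Hw Hder H0; apply Cmod_gt0 in Hw; pose proof (Cmod_ge0 lam).
  destruct (lprod_vanishes l lam Hin) as [L [HL HLu]].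
  destruct (cval_lipschitz d (Cmod lam + 1) ltac:(lra) Hd) as [K [HK HLip]].
  destruct (Hder (Cmod w / 2) ltac:(lra)) as [delta [Hdelta Hu]].
  assert (HLK : 0 <= L * K) by nra.
  (* The increment has modulus at least [Cmod w * t / 2] and at most [L * K * t * t]; the last bound
     on [t] makes these incompatible. *)
  set (t := Rmin (Rmin 1 (delta / 2)) (Cmod w / (4 * (L * K + 1)))).
  assert (Ht : 0 < t).
  { apply Rmin_pos; [apply Rmin_pos; lra|apply Rdiv_lt_0_compat; lra]. }
  assert (Ht1 : t <= 1 /\ t <= delta / 2).
  { pose proof (Rmin_l (Rmin 1 (delta / 2)) (Cmod w / (4 * (L * K + 1)))) as H1; fold t in H1.
    pose proof (Rmin_l 1 (delta / 2)); pose proof (Rmin_r 1 (delta / 2)); lra. }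
  assert (Ht2 : t * (4 * (L * K + 1)) <= Cmod w).
  { pose proof (Rmin_r (Rmin 1 (delta / 2)) (Cmod w / (4 * (L * K + 1)))) as H1; fold t in H1.
    apply (Rmult_le_compat_r (4 * (L * K + 1))) in H1; [|lra].
    now replace (Cmod w / (4 * (L * K + 1)) * (4 * (L * K + 1))) with (Cmod w) in H1
      by (field; lra). }
  assert (Hmt : Cmod (RtoC t) = t) by (rewrite Cmod_RtoC; apply Rabs_pos_eq; lra).
  specialize (Hu (RtoC t) ltac:(lra)); specialize (HLu (RtoC t) ltac:(lra)).
  pose proof (Cmod_triangle lam (RtoC t)) as Htri.
  specialize (HLip (lam + RtoC t)%C lam ltac:(lra) ltac:(lra)).
  replace (lam + RtoC t - lam)%C with (RtoC t) in HLip by ring.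
  rewrite H0 in HLip.
  replace (cval d (lam + RtoC t) - C0)%C with (cval d (lam + RtoC t))%C in HLip by ring.
  assert (Hc0 : cval c lam = C0) by (rewrite E, H0; ring).
  assert (Hct : Cmod (cval c (lam + RtoC t)%C) <= L * t * (K * t)).
  { rewrite E, Cmod_mul, Hmt in *; apply Rmult_le_compat; try apply Cmod_ge0; lra. }
  rewrite Hc0 in Hu.
  replace (cval c (lam + RtoC t) - C0 - w * RtoC t)%C
    with (- (w * RtoC t - cval c (lam + RtoC t)))%C in Hu by ring.
  rewrite Cmod_opp in Hu.
  pose proof (Cmod_triangle_inv (w * RtoC t) (cval c (lam + RtoC t)))%C as H1.
  rewrite Cmod_mul, Hmt in *.
  assert (H2 : Cmod w * t <= 2 * (L * K * t) * t) by nra.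
  apply Rmult_le_reg_r in H2; [|exact Ht]; nra.
Qed.

Lemma list_lower_bound (f : Cplx -> R) (l : list Cplx) :
  exists m, 0 < m /\ forall t, In t l -> 0 < f t -> m <= f t.
Proof.
  induction l as [|x l [m [Hm IH]]]; [exists 1; split; [lra|easy]|].
  destruct (Rlt_dec 0 (f x)) as [Hx|Hx].
  - exists (Rmin m (f x)); split; [now apply Rmin_pos|].
    intros t [->|Ht] Hpos; [apply Rmin_r|].
    eapply Rle_trans; [apply Rmin_l|auto].
  - exists m; split; [exact Hm|]; intros t [->|Ht] Hpos; [lra|auto].
Qed.

(** By the Lipschitz bound the modulus loses at most half of its value at the centre on each disc of
    a finite cover. Nonvanishing is required on the double disc because the centres may lie
    there. *)
Lemma cval_lower_bound (c : nat -> Cplx) (r : R) : 0 < r -> entire c ->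
  (forall z, Cmod z <= 2 * r -> cval c z <> C0) ->
  exists delta, 0 < delta /\ forall z, Cmod z <= r -> delta <= Cmod (cval c z).
Proof.
  intros Hr Hc Hnz.
  destruct (cval_lipschitz c (2 * r) ltac:(lra) Hc) as [K [HK HL]].
  destruct (disc_cover r (fun t => Cmod (cval c t) / (2 * (K + 1)))) as [l Hl].
  { intros t Ht; apply Rdiv_lt_0_compat; [apply Cmod_gt0; auto|lra]. }
  destruct (list_lower_bound (fun t => Cmod (cval c t)) l) as [m [Hm Hlow]].
  exists (m / 2); split; [lra|]; intros z Hz.
  destruct (Hl z Hz) as [t [Htl [Ht Hzt]]].
  specialize (Hlow t Htl (Cmod_gt0 _ (Hnz t Ht))).
  specialize (HL z t ltac:(lra) ltac:(lra)).
  apply (Rmult_lt_compat_r (2 * (K + 1))) in Hzt; [|lra].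
  replace (Cmod (cval c t) / (2 * (K + 1)) * (2 * (K + 1))) with (Cmod (cval c t)) in Hzt
    by (field; lra).
  pose proof (Cmod_triangle_inv (cval c t) (cval c z)) as H.
  rewrite Cmod_sub_sym in H; pose proof (Cmod_ge0 (z - t)%C); nra.
Qed.

(* The zeros of [c] in a large disc divide out, and the remaining factor can
   be cancelled at any [a] of norm at most [r]. *)
Lemma annihilating_product (c : nat -> Cplx) (r : R) : 0 < r -> entire c ->
  (forall z, cval c z = C0 -> exists w, w <> C0 /\ Cderiv (cval c) z w) ->
  exists l, NoDup l /\ forall (A : BanachAlgebra) (a : A), bnorm A a <= r ->
    fcalc A c a (bzero A) -> lprod A a l = bzero A.
Proof.
  intros Hr Hc Hs.
  (* Cancellation at norm [r] needs a lower bound on the disc of radius [4 * r], and this needs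
     nonvanishing on twice that radius. *)
  destruct (zeros_finite c (2 * (4 * r)) Hc Hs) as [l [Hnd [Hzero Hl]]].
  destruct (factor_zeros l c Hc Hnd Hzero) as [d [Hd HA]].
  assert (E : forall z, cval c z = (lprod CplxBA z l * cval d z)%C).
  { intros z; apply cval_eq; [exact Hc|]; apply (HA CplxBA), cvalP, Hd. }
  destruct (cval_lower_bound d (4 * r) ltac:(lra) Hd) as [delta [Hdelta Hlow]].
  { intros z Hz H0.
    assert (Hcz : cval c z = C0) by (rewrite E, H0; ring).
    destruct (Hs z Hcz) as [w [Hw Hder]].
    exact (quotient_nonzero c d l z w Hd E (Hl z Hz Hcz) Hw Hder H0). }
  exists l; split; [exact Hnd|]; intros A a Ha H0.
  destruct (fcalc_entire_ex A d a Hd) as [y Hy].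
  apply (fcalc_cancel A a y _ d (4 * r) delta); try assumption; try lra.
  apply (bconv_unique A (psum A c a)); [exact (HA A a y Hy)|exact H0].
Qed.

(** * Eigenvectors *)

Lemma C_n_0 (n : nat) : C n 0 = 1.
Proof.
  unfold C; rewrite Nat.sub_0_r; simpl; field; apply INR_fact_neq_0.
Qed.

Lemma C_n_n (n : nat) : C n n = 1.
Proof.
  unfold C; rewrite Nat.sub_diag; simpl; field; apply INR_fact_neq_0.
Qed.

Lemma Cbinomial_sub (x y : Cplx) (n : nat) :
  Csum (fun k => RtoC ((-1) ^ k * C n k) * (Cpow x (n - k) * Cpow y k))%C n =
  Cpow (x - y)%C n.
Proof.
  set (f := fun n k => (RtoC ((-1) ^ k * C n k) * (Cpow x (n - k) * Cpow y k))%C).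
  change (Csum (f n) n = Cpow (x - y)%C n); induction n as [|n IH].
  - unfold f; simpl; rewrite C_n_0; apply Cplx_ext; simpl; ring.
  (* Pascal's rule summed up to [m]: the shifted sum falls short by the boundary term [y * f n m].
     At [m = n] the remaining term of index [n + 1] cancels it. *)
  - assert (H : forall m, (m <= n)%nat ->
      Csum (f (S n)) m = ((x - y) * Csum (f n) m + y * f n m)%C).
    { induction m as [|m IHm]; intros Hm.
      - unfold f; simpl Csum; rewrite !C_n_0, !Nat.sub_0_r; simpl; ring.
      - rewrite !Csum_S, IHm by lia; unfold f.
        rewrite <- (pascal n m) by lia.
        replace (S n - S m)%nat with (S (n - S m)) by lia.
        replace (n - m)%nat with (S (n - S m)) by lia.
        replace (RtoC ((-1) ^ S m * (C n m + C n (S m))))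
          with (RtoC ((-1) ^ S m * C n (S m)) - RtoC ((-1) ^ m * C n m))%C
          by (apply Cplx_ext; simpl; ring).
        simpl Cpow; ring. }
    rewrite Csum_S, H, IH by lia; unfold f; rewrite !C_n_n, !Nat.sub_diag.
    replace (RtoC ((-1) ^ S n * 1)) with (- RtoC ((-1) ^ n * 1))%C
      by (apply Cplx_ext; simpl; ring).
    simpl; ring.
Qed.

Section Eigenvectors.
Variable A : BanachAlgebra.
Add Ring sqz_ring_inst : (sqz_ring A).

(** The operator is abstract so that one argument covers right multiplication by [a] and left
    multiplication by [b]. *)
Fixpoint op_prod (T : A -> A) (l : list Cplx) (x : A) : A :=
  match l with
  | nil => x
  | lam :: l => op_prod T l (T x - lam *: x)%A
  end.

(* An induction principle expressing that an operator annihilated by a product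
   of distinct linear factors is diagonalizable. *)
Lemma eigenvector_ind (T : A -> A) (l : list Cplx) :
  (forall x y, T (x + y) = T x + T y)%A ->
  (forall c x, T (c *: x) = c *: T x)%A -> NoDup l ->
  forall Q : A -> Prop, Q 0%A -> (forall x y, Q x -> Q y -> Q (x + y)%A) ->
  (forall lam v, In lam l -> T v = (lam *: v)%A -> Q v) ->
  forall x, op_prod T l x = 0%A -> Q x.
Proof.
  intros Tadd Tscal; induction l as [|lam l IH]; intros Hl Q Q0 Qadd Qeig x Hx.
  - simpl in Hx; now rewrite Hx.
  - inversion Hl as [|? ? Hnin Hl']; subst.
    assert (T0 : T 0%A = 0%A).
    { rewrite <- (bscal_C0 A 0%A) at 1; rewrite Tscal; apply bscal_C0. }
    (* On eigenvectors for [mu] distinct from [lam] the operator [T - lam] is invertible, so the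
       induction lifts [(T - lam) x] to some [s] satisfying [Q]; then [x - s] is an eigenvector for
       [lam]. *)
    destruct (IH Hl' (fun y => exists s, Q s /\ (T s - lam *: s)%A = y))
      with (x := (T x - lam *: x)%A) as [s [Hs E]].
    + exists 0%A; split; [exact Q0|rewrite T0; algebra].
    + intros y y' [s [Hs <-]] [s' [Hs' <-]]; exists (s + s')%A; split; [auto|].
      rewrite Tadd; algebra.
    + intros mu v Hmu Hv.
      assert (Hne : (mu - lam)%C <> C0).
      { intros E; apply Csub_eq0 in E; subst mu; contradiction. }
      exists (Cinv (mu - lam)%C *: v)%A; split.
      * apply (Qeig mu); [now right|]; rewrite Tscal, Hv; algebra.
      * rewrite Tscal, Hv.
        replace v with (((mu - lam) * Cinv (mu - lam))%C *: v)%A at 3.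
        { algebra. }
        replace ((mu - lam) * Cinv (mu - lam))%C with C1 by (field; exact Hne).
        apply bscal_1.
    + exact Hx.
    + replace x with (s + (x - s))%A by algebra.
      apply Qadd; [exact Hs|apply (Qeig lam); [now left|]].
      rewrite Tadd, bopp_scal, Tscal, <- bopp_scal.
      replace (T s) with ((T s - lam *: s) + lam *: s)%A by algebra.
      rewrite E; algebra.
Qed.

Lemma op_prod_mulr (a : A) (l : list Cplx) (x : A) :
  op_prod (fun y => y * a)%A l x = (x * lprod A a l)%A.
Proof.
  revert x; induction l as [|lam l IH]; intros x; simpl; [algebra|].
  rewrite IH; algebra.
Qed.

Lemma lprod_comm (a : A) (l : list Cplx) : (a * lprod A a l = lprod A a l * a)%A.
Proof.
  induction l as [|lam l IH]; simpl; [algebra|].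
  rewrite bmul_assoc_r, <- IH; algebra.
Qed.

Lemma op_prod_mull (a : A) (l : list Cplx) (x : A) :
  op_prod (fun y => a * y)%A l x = (lprod A a l * x)%A.
Proof.
  revert x; induction l as [|lam l IH]; intros x; simpl; [algebra|].
  rewrite IH, bmul_addr, bmul_assoc, <- lprod_comm; algebra.
Qed.

Lemma bsum_mull (x : A) (f : nat -> A) (n : nat) :
  (x * bsum A f n = bsum A (fun k => x * f k) n)%A.
Proof.
  induction n as [|n IH]; [now rewrite !bsum_0|].
  now rewrite !bsum_S, bmul_addr, IH.
Qed.

Lemma bsum_mulr (f : nat -> A) (x : A) (n : nat) :
  (bsum A f n * x = bsum A (fun k => f k * x) n)%A.
Proof.
  induction n as [|n IH]; [now rewrite !bsum_0|].
  now rewrite !bsum_S, bmul_addl, IH.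
Qed.

Lemma bsum_scal (f : nat -> Cplx) (x : A) (n : nat) :
  bsum A (fun k => f k *: x)%A n = (Csum f n *: x)%A.
Proof.
  induction n as [|n IH]; [now rewrite bsum_0|].
  now rewrite bsum_S, IH, <- bscal_addl.
Qed.

Section Sandwich.
Variables (a b v w : A) (lam mu : Cplx).
Hypotheses (Hv : (v * a = lam *: v)%A) (Hw : (b * w = mu *: w)%A).

Lemma bpow_eigl (n : nat) : (v * bpow A a n = Cpow lam n *: v)%A.
Proof.
  induction n as [|n IH]; simpl; [now rewrite bmul_1r, bscal_1|].
  rewrite bmul_assoc, Hv, bmul_scall, IH; apply bscal_assoc.
Qed.

Lemma bpow_eigr (n : nat) : (bpow A b n * w = Cpow mu n *: w)%A.
Proof.
  induction n as [|n IH]; simpl; [now rewrite bmul_1l, bscal_1|].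
  rewrite bmul_assoc_r, IH, bmul_scalr, Hw, bscal_assoc; f_equal; ring.
Qed.

Lemma Cab_eig (n : nat) :
  (v * Cab A a b n * w = Cpow (lam - mu)%C n *: (v * w))%A.
Proof.
  unfold Cab; rewrite bsum_mull, bsum_mulr, <- Cbinomial_sub, <- bsum_scal.
  apply bsum_ext; intros k _.
  rewrite bmul_scalr, bmul_scall, <- bscal_assoc; f_equal.
  rewrite bmul_assoc, bpow_eigl, bmul_assoc_r, bpow_eigr.
  rewrite bmul_scall, bmul_scalr; apply bscal_assoc.
Qed.

End Sandwich.

Lemma nroot_le_pow (x eps : R) (n : nat) : (n >= 1)%nat -> 0 < eps ->
  nroot n x <= eps -> x <= eps ^ n.
Proof.
  intros Hn He H; unfold nroot in H; destruct (Rle_dec x 0) as [Hx|Hx].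
  - pose proof (pow_lt eps n He); lra.
  - assert (E : x = Rpower x (/ INR n) ^ n).
    { pose proof (lt_0_INR n ltac:(lia)).
      rewrite <- Rpower_pow by apply exp_pos.
      rewrite Rpower_mult, Rinv_l, Rpower_1 by lra; reflexivity. }
    rewrite E; apply pow_incr; split; [left; apply exp_pos|exact H].
Qed.

Lemma eig_orthogonal (a b v w : A) (lam mu : Cplx) : rho_zero A a b ->
  (v * a = lam *: v)%A -> (b * w = mu *: w)%A -> lam <> mu -> (v * w = 0)%A.
Proof.
  intros Hrho Hv Hw Hne.
  assert (HD : 0 < Cmod (lam - mu)%C).
  { apply Cmod_gt0; intros E; apply Hne, Csub_eq0, E. }
  set (D := Cmod (lam - mu)%C) in *.
  (* Half the eigenvalue gap: after division by [D ^ n] a factor [(/ 2) ^ n] remains. *)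
  destruct (Hrho (D / 2) ltac:(lra)) as [N HN].
  apply bnorm_eq0, Rle_antisym; [|apply bnorm_ge0].
  apply le_epsilon; intros eps He; rewrite Rplus_0_l.
  destruct (half_pow_small (bnorm A v * bnorm A w) eps He) as [N' HN'].
  set (n := (N + N' + 1)%nat).
  specialize (HN n ltac:(lia)); specialize (HN' n ltac:(lia)).
  apply nroot_le_pow in HN; [|lia|lra].
  pose proof (Cab_eig a b v w lam mu Hv Hw n) as E; apply (f_equal (bnorm A)) in E.
  rewrite bnorm_scal, Cmod_pow in E; fold D in E.
  pose proof (bnorm_submult A (v * Cab A a b n)%A w) as H1.
  pose proof (bnorm_submult A v (Cab A a b n)) as H2.
  pose proof (bnorm_ge0 A v); pose proof (bnorm_ge0 A w); pose proof (pow_lt D n HD).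
  assert (Hle : D ^ n * bnorm A (v * w)%A <= D ^ n * (bnorm A v * bnorm A w * (/ 2) ^ n)).
  { rewrite <- E; eapply Rle_trans; [exact H1|].
    apply Rle_trans with (bnorm A v * (D / 2) ^ n * bnorm A w).
    - apply Rmult_le_compat_r; [lra|]; eapply Rle_trans; [exact H2|].
      now apply Rmult_le_compat_l.
    - unfold Rdiv; rewrite Rpow_mult_distr; right; ring. }
  apply Rmult_le_reg_l in Hle; lra.
Qed.

Lemma eq_of_rho_zero (a b : A) (l : list Cplx) : NoDup l ->
  lprod A a l = 0%A -> lprod A b l = 0%A -> rho_zero A a b -> a = b.
Proof.
  intros Hl Ha Hb Hrho; apply bsub_eq0.
  (* The claim is linear in each of two units, one inserted here on the left and one later on the
     right, so it reduces to eigenvectors in both places. *)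
  rewrite <- (bmul_1l A (a - b)%A).
  apply (eigenvector_ind (fun y => y * a)%A l) with (Q := fun v => (v * (a - b) = 0)%A).
  - intros; apply bmul_addl.
  - intros; apply bmul_scall.
  - exact Hl.
  - apply bmul_0l.
  - intros x y Hx Hy; rewrite bmul_addl, Hx, Hy; apply badd_0.
  - intros lam v _ Hv; rewrite <- (bmul_1r A (a - b)%A).
    apply (eigenvector_ind (fun y => b * y)%A l)
      with (Q := fun w => (v * ((a - b) * w) = 0)%A).
    + intros; apply bmul_addr.
    + intros; apply bmul_scalr.
    + exact Hl.
    + now rewrite !bmul_0r.
    + intros x y Hx Hy; rewrite !bmul_addr, Hx, Hy; apply badd_0.
    + intros mu w _ Hw.
      assert (E : (v * ((a - b) * w) = (lam - mu)%C *: (v * w))%A).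
      { rewrite bmul_addl, bmul_addr, bmul_oppl, Hw, (bmul_assoc A v a), Hv; algebra. }
      rewrite E; destruct (classic (lam = mu)) as [->|Hne].
      * replace (mu - mu)%C with C0 by ring; apply bscal_C0.
      * rewrite (eig_orthogonal a b v w lam mu Hrho Hv Hw Hne); apply bscal_0.
    + rewrite op_prod_mull, Hb; apply bmul_0l.
  - rewrite op_prod_mulr, Ha; apply bmul_0r.
Qed.

End Eigenvectors.

Theorem theorem2p2 (A : BanachAlgebra) (a b : A)
  (h : Cplx -> Cplx) (c : nat -> Cplx)
  (Hentire : entire_with_coeffs h c)
  (Hnonzero : exists z, h z <> C0)
  (Hsimple : forall z, h z = C0 -> exists w, w <> C0 /\ Cderiv h z w)
  (Hdrho : d_rho_zero A a b)
  (Ha : fcalc A c a (bzero A))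
  (Hb : fcalc A c b (bzero A)) :
  a = b.
Proof.
  assert (Hval : forall z, has_value c z (h z)).
  { intros z; apply ps_conv_has_value, Hentire. }
  assert (Hc : entire c).
  { apply everywhere_convergent_entire; intros z; exists (h z); apply Hval. }
  assert (E : forall z, cval c z = h z) by (intros z; apply cval_eq; auto).
  pose proof (bnorm_ge0 A a); pose proof (bnorm_ge0 A b).
  (* A single radius above both norms, so that one list of zeros annihilates [a] and [b] alike. *)
  destruct (annihilating_product c (bnorm A a + bnorm A b + 1) ltac:(lra) Hc)
    as [l [Hl HA]].
  { intros z Hz; rewrite E in Hz; destruct (Hsimple z Hz) as [w [Hw Hd]].
    exists w; split; [exact Hw|]; intros eps He.
    destruct (Hd eps He) as [delta [Hdelta Hu]].
    exists delta; split; [exact Hdelta|]; intros u; rewrite !E; apply Hu. }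
  apply (eq_of_rho_zero A a b l Hl); [apply HA; [lra|exact Ha]|
    apply HA; [lra|exact Hb]|apply Hdrho].
Qed.
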